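(* Let $\mathcal I$ be a $\sigma$-ideal on a compact metrizable space $Z=\bigcup\mathcal I\notin\mathcal I$. If $\mathcal I$ is Borel-on-Borel, then for every countable ordinal $\alpha\geq 1$ the triple $(\mathcal I,\Delta^1_1,\Pi^0_\alpha)$ has the property $\mathbf{(H)}$. Consequently, for every non-locally compact Polish group $X$ containing a topological copy of $Z$ (and every countable ordinal $\alpha\ge 1$), there exists a Borel Haar-$1$ subset $E\subset X$ which cannot be enlarged to a Haar-$\mathcal I$ set $H\in\Pi^0_\alpha(X)$ (that is, no Haar-$\mathcal I$ set $H\in\Pi^0_\alpha(X)$ contains $E$).
   Context: All groups are Abelian, written additively; a Polish group is a topological group whose underlying space is Polish. A semi-ideal on a set is a nonempty family of subsets closed under taking subsets; a $\sigma$-ideal is a semi-ideal closed under countable unions. For a semi-ideal $\mathcal I$ on a nonempty compact space $Z=\bigcup\mathcal I$, a subset $A$ of a Polish group $X$ is Haar-$\mathcal I$ if there is a continuous map $f:Z\to X$ with $f^{-1}(A+x)\in\mathcal I$ for all $x\in X$. A subset $A\subset X$ is Haar-$1$ if there is a continuous map $f:2^\omega\to X$ with $|f^{-1}(A+x)|\le 1$ for all $x\in X$. $C(Z,X)$ is the Polish space of continuous maps $Z\to X$ with the compact-open topology. A pointclass $\Gamma$ assigns to each Polish space $X$ a family $\Gamma(X)$ of subsets of $X$ such that: for every continuous map $f:X\to Y$ between Polish spaces and every $B\in\Gamma(Y)$ we have $f^{-1}(B)\in\Gamma(X)$; and for every Polish space $X$, $\emptyset,X\in\Gamma(X)$ and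 $A\cap B,\,A\cup B\in\Gamma(X)$ for all $A,B\in\Gamma(X)$. The dual pointclass is $\Gamma^c(X)=\{A\subset X:X\setminus A\in\Gamma(X)\}$. $\Delta^1_1(X)$ is the family of Borel subsets of $X$, and $\Pi^0_\alpha(X)$ is the $\alpha$-th multiplicative Borel class of $X$ ($\Pi^0_1$ = closed sets, $\Pi^0_2=G_\delta$, etc.). A family $\mathcal I$ of subsets of a Polish space $Z$ is $\Lambda$-on-$\Gamma$ if for any Polish space $Y$ and any $A\in\Gamma(Z\times Y)$ we have $\{y\in Y:A_y\in\mathcal I\}\in\Lambda(Y)$, where $A_y=\{z\in Z:(z,y)\in A\}$; Borel-on-Borel means $\Delta^1_1$-on-$\Delta^1_1$. For a semi-ideal $\mathcal I$ on a compact metrizable space $Z=\bigcup\mathcal I$ and pointclasses $\Gamma,\Lambda$, the triple $(\mathcal I,\Gamma,\Lambda)$ has the property $\mathbf{(H)}$ if: (H1) for any $A\in\mathcal I$ the set $Z\setminus A$ does not belong to $\mathcal I$; (H2) for any Polish space $P$ there is a set $U\in\Gamma(2^\omega\times P)$ such that for every $A\in\Lambda^c(P)$ there is $x\in 2^\omega$ with $\{p\in P:(x,p)\in U\}=A$; (H3) $\mathcal I$ is $\Gamma^c$-on-$\Gamma$; (H4) for any Polish spaces $X,Y$, if $A\in\Gamma(C(Z,X)\times Y\times X)$ is such that for every $(h,y)\in C(Z,X)\times Y$ the section $A_{(h,y)}:=\{g\in X:(h,y,g)\in A\}$ is either empty or satisfies $h^{-1}(A_{(h,y)})\notin\mathcal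 I$, then $A$ has a uniformization $\phi\in\Gamma(C(Z,X)\times Y\times X)$, i.e. $\phi\subset A$ and for any $(h,y)$ with $A_{(h,y)}\neq\emptyset$ the section $\phi_{(h,y)}$ is a singleton; (H5) for any Borel injection $f:X\to Y$ between Polish spaces, $\{f(A):A\in\Gamma(X)\}\subset\Gamma(Y)$. *)

(* Defs.v *)
From HB Require Import structures.
From mathcomp Require Import all_boot all_order all_algebra.
From mathcomp Require Import all_classical all_reals all_analysis.

Set Implicit Arguments.
Unset Strict Implicit.
Unset Printing Implicit Defensive.

Import Order.TTheory GRing.Theory Num.Theory.

Local Open Scope classical_set_scope.
Local Open Scope ring_scope.

Definition homeomorphic (X Y : topologicalType) : Prop :=
  exists (f : X -> Y) (g : Y -> X),
    [/\ continuous f, continuous g, cancel f g & cancel g f].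

Definition embedding (X Y : topologicalType) (f : X -> Y) : Prop :=
  injective f /\
  forall U : set X, open U <-> exists2 V : set Y, open V & f @^-1` V = U.

Definition separable (X : topologicalType) : Prop :=
  exists2 D : set X, countable D & dense D.

Definition metrizable (R : realType) (X : topologicalType) : Prop :=
  exists M : metricType R, homeomorphic X M.

(* [completeType] is not used because the library forces it to be pointed,
   whereas the empty space is Polish. *)
Definition complete_metric (R : realType) (M : metricType R) : Prop :=
  forall F : set_system M, ProperFilter F -> cauchy F -> exists l : M, F --> l.

Definition polish (R : realType) (X : topologicalType) : Prop :=
  separable X /\
  exists2 M : metricType R, complete_metric M & homeomorphic X M.

Definition compact_open_map (Z X : topologicalType) : Type :=
  initial_topology
    (fun h : continuousType Z X => (h : Z -> X) : {compact-open, Z -> X}).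

HB.instance Definition _ (Z X : topologicalType) :=
  Topological.copy (compact_open_map Z X)
    (initial_topology
      (fun h : continuousType Z X => (h : Z -> X) : {compact-open, Z -> X})).

Definition semi_ideal (T : Type) (I : set (set T)) : Prop :=
  I !=set0 /\ forall A B : set T, A `<=` B -> I B -> I A.

Definition sigma_ideal (T : Type) (I : set (set T)) : Prop :=
  semi_ideal I /\
  forall F : (set T)^nat, (forall n, I (F n)) -> I (\bigcup_n F n).

(* The values on non-Polish spaces are irrelevant: every definition below only
   ever applies a family to Polish spaces. *)
Definition set_class := forall X : topologicalType, set (set X).

Definition is_pointclass (R : realType) (G : set_class) : Prop :=
  (forall (X Y : topologicalType) (f : X -> Y), polish R X -> polish R Y ->
     continuous f -> forall B : set Y, G Y B -> G X (f @^-1` B)) /\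
  (forall X : topologicalType, polish R X ->
     [/\ G X set0, G X setT,
         forall A B : set X, G X A -> G X B -> G X (A `&` B) &
         forall A B : set X, G X A -> G X B -> G X (A `|` B)]).

Definition dual (G : set_class) : set_class := fun X => [set A | G X (~` A)].

Definition borel : set_class := fun X => <<s @open X>>.

Definition borel_map (X Y : topologicalType) (f : X -> Y) : Prop :=
  forall B : set Y, borel B -> borel (f @^-1` B).

(* A countable ordinal is represented by an element of a countable well-order,
   and stands for the order type of its set of strict predecessors. Every
   countable ordinal arises in this way, e.g. as the last element of a
   well-order of type a + 1. *)
Definition ord_ge1 (d : Order.disp_t) (W : orderType d) (a : W) : Prop :=
  exists b : W, (b < a)%O.

Definition ord_eq1 (d : Order.disp_t) (W : orderType d) (a : W) : Prop :=
  exists b : W, [set c : W | (c < a)%O] = [set b].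

Inductive multiplicative_class (d : Order.disp_t) (W : orderType d)
    (X : topologicalType) : W -> set X -> Prop :=
| multiplicative_closed (a : W) (A : set X) :
    ord_eq1 a -> closed A -> multiplicative_class a A
| multiplicative_bigcap (a : W) (b : nat -> W) (A : (set X)^nat) :
    (forall n, ord_ge1 (b n)) -> (forall n, (b n < a)%O) ->
    (forall n, multiplicative_class (b n) (~` A n)) ->
    multiplicative_class a (\bigcap_n A n).

Definition Pi0 (d : Order.disp_t) (W : orderType d) (a : W) : set_class :=
  fun X => [set A : set X | multiplicative_class a A].

Definition class_on_class (R : realType) (L G : set_class)
    (Z : topologicalType) (I : set (set Z)) : Prop :=
  forall Y : topologicalType, polish R Y ->
  forall A : set (Z * Y)%type, G (Z * Y)%type A ->
    L Y [set y | I (ysection A y)].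

Record property_H (R : realType) (Z : topologicalType) (I : set (set Z))
    (G L : set_class) : Prop := PropertyH {
  H_compact : compact [set: Z];
  H_metrizable : metrizable R Z;
  H_semi_ideal : semi_ideal I;
  H_cover : \bigcup_(A in I) A = [set: Z];
  H_pointclass_G : is_pointclass R G;
  H_pointclass_L : is_pointclass R L;
  H1 : forall A : set Z, I A -> ~ I (~` A);
  H2 : forall P : topologicalType, polish R P ->
    exists2 U : set (cantor_space * P)%type, G (cantor_space * P)%type U &
      forall A : set P, dual L A -> exists x : cantor_space, xsection U x = A;
  H3 : class_on_class R (dual G) G I;
  H4 : forall X Y : topologicalType, polish R X -> polish R Y ->
    forall A : set (compact_open_map Z X * Y * X)%type,
    G (compact_open_map Z X * Y * X)%type A ->
    (forall (h : compact_open_map Z X) (y : Y),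
       xsection A (h, y) = set0 \/
       ~ I ((h : continuousType Z X) @^-1` xsection A (h, y))) ->
    exists phi : set (compact_open_map Z X * Y * X)%type,
      [/\ G (compact_open_map Z X * Y * X)%type phi, phi `<=` A &
          forall (h : compact_open_map Z X) (y : Y),
            xsection A (h, y) !=set0 ->
            exists g : X, xsection phi (h, y) = [set g]];
  H5 : forall (X Y : topologicalType) (f : X -> Y),
    polish R X -> polish R Y -> injective f -> borel_map f ->
    forall A : set X, G X A -> G Y (f @` A)
}.

Definition haar (X : topologicalZmodType) (Z : topologicalType)
    (I : set (set Z)) (A : set X) : Prop :=
  exists2 f : Z -> X, continuous f &
    forall x : X, I (f @^-1` [set a + x | a in A]).

Definition haar1 (X : topologicalZmodType) (A : set X) : Prop :=
  exists2 f : cantor_space -> X, continuous f &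
    forall x : X, is_subset1 (f @^-1` [set a + x | a in A]).

(* Main.v *)
Require Import Defs.
From HB Require Import structures.
From mathcomp Require Import all_boot all_order all_algebra.
From mathcomp Require Import all_classical all_reals all_analysis.

Set Implicit Arguments.
Unset Strict Implicit.
Unset Printing Implicit Defensive.

Import Order.TTheory GRing.Theory Num.Theory.

Local Open Scope classical_set_scope.
Local Open Scope ring_scope.

(** The ideal being Borel-on-Borel, the statement is a matter of classical
    descriptive set theory, which is developed here from one notion: a complete
    cover of a set is a sequence of countable Borel covers such that every filter
    picking a member of each of them converges inside the set.  Every Borel subset
    of a Polish space has one ([borel_has_complete_cover]).  Following branches of
    successive choices in such covers proves the separation of disjoint images of
    Borel sets ([image_separation]), hence the theorem of Lusin and Souslin that
    injective Borel images of Borel sets are Borel ([injective_borel_image]), and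
    also the existence of Borel uniformizations for Borel sets with large sections
    ([large_section_uniformization]): the small subsets of a section are those
    with a preimage in the ideal, and the leftmost branch of nodes with large
    sections depends on the parameter in a Borel way.  The space of continuous maps
    on the compact space is Polish ([polish_compact_open_map]) and evaluation is
    continuous on it, which is what lets the Borel-on-Borel hypothesis apply to it.
    Universal sets for the additive classes come from well-founded induction
    ([universal_additive]).  Together this is property (H).

    For the second half, let the group not be locally compact.  It is complete in
    its group uniformity ([polish_group_complete]), so small neighbourhoods of [0]
    are not totally bounded, and this leaves room for series whose sums differ so
    much that translating compact sets by them makes the sets disjoint
    ([separated_sums]).  One obtains translations [t (h, x)], indexed by continuous
    maps [h] and points [x] of the Cantor space, that make all the compact sets
    [range h - range f] disjoint, where [range f] is a fixed Cantor set
    ([disjoint_translates]).  Choosing in a Borel way one point [g] of [range h]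
    for each pair [(h, x)] and collecting the points [t (h, x) + g] then gives a
    set that every translate of [range f] meets at most once, so a Haar-1 set, and
    it is Borel as an injective image.  The points are chosen diagonally, with the
    help of a universal set and of the uniformization theorem, so that every hull
    of the allowed class has, for every candidate [h], a translate with large
    preimage ([borel_haar1_without_hull]). *)

(** * Borel sets and Borel maps *)

Section borel_sets.
Context {T : topologicalType}.
Implicit Types A B : set T.

Lemma borel_open A : open A -> borel A.
Proof. exact: sub_sigma_algebra. Qed.

Lemma borelC A : borel A -> borel (~` A).
Proof. by move=> bA; rewrite -setTD; exact: sigma_algebraCD. Qed.

Lemma borel0 : borel (@set0 T).
Proof. exact: sigma_algebra0. Qed.

Lemma borelT : borel [set: T].
Proof. by rewrite -setC0; apply: borelC; exact: borel0. Qed.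

Lemma borel_closed A : closed A -> borel A.
Proof. by move=> cA; rewrite -(setCK A); apply: borelC; apply: borel_open; exact: closed_openC. Qed.

Lemma borel_bigcup_nat (F : (set T)^nat) :
  (forall n, borel (F n)) -> borel (\bigcup_n F n).
Proof. exact: sigma_algebra_bigcup. Qed.

Lemma borel_bigcup (I : Type) (D : set I) (F : I -> set T) : countable D ->
  (forall i, D i -> borel (F i)) -> borel (\bigcup_(i in D) F i).
Proof.
move=> /pfcard_geP[-> _|/unsquash f bF]; first by rewrite bigcup_set0; exact: borel0.
have -> : \bigcup_(i in D) F i = \bigcup_n F (f n).
  apply/seteqP; split=> x [i]; last by move=> _ Fx; exists (f i) => //; exact: funS.
  by move=> Di Fx; have [n _ fn] := @surj _ _ _ _ f i Di; exists n => //; rewrite fn.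
by apply: borel_bigcup_nat => n; apply: bF; exact: funS.
Qed.

Lemma borel_bigcap (I : Type) (D : set I) (F : I -> set T) : countable D ->
  (forall i, D i -> borel (F i)) -> borel (\bigcap_(i in D) F i).
Proof.
move=> cD bF; rewrite -(setCK (\bigcap_(i in D) F i)) setC_bigcap.
by apply: borelC; apply: borel_bigcup => // i Di; apply: borelC; exact: bF.
Qed.

Lemma borelU A B : borel A -> borel B -> borel (A `|` B).
Proof.
move=> bA bB; rewrite -bigcup2E; apply: borel_bigcup_nat.
by move=> [|[|n]] //=; exact: borel0.
Qed.

Lemma borelI A B : borel A -> borel B -> borel (A `&` B).
Proof.
move=> bA bB; rewrite -(setCK (A `&` B)) setCI.
by apply: borelC; apply: borelU; exact: borelC.
Qed.

Lemma borelD A B : borel A -> borel B -> borel (A `\` B).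
Proof. by move=> bA bB; rewrite setDE; apply: borelI => //; exact: borelC. Qed.

Lemma borel_ind (P : set (set T)) : (forall A, open A -> P A) ->
  (forall A, P A -> P (~` A)) ->
  (forall F : (set T)^nat, (forall n, P (F n)) -> P (\bigcup_n F n)) ->
  forall A, borel A -> P A.
Proof.
move=> Po Pc Pu A; apply: smallest_sub; last exact: Po.
split=> [|B PB|F PF]; first exact/Po/open0; last exact: Pu.
by rewrite setTD; exact: Pc.
Qed.

End borel_sets.

Lemma borel_map_open (X Y : topologicalType) (f : X -> Y) :
  (forall U, open U -> borel (f @^-1` U)) -> borel_map f.
Proof.
move=> bf B; apply: (borel_ind (P := fun B => borel (f @^-1` B))) => //.
- by move=> A; rewrite preimage_setC; exact: borelC.
- by move=> F bF; rewrite preimage_bigcup; exact: borel_bigcup_nat.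
Qed.

Lemma continuous_borel_map (X Y : topologicalType) (f : X -> Y) :
  continuous f -> borel_map f.
Proof.
by move=> /continuousP cf; apply: borel_map_open => U /cf; exact: borel_open.
Qed.

Lemma borel_map_comp (X Y Z : topologicalType) (f : X -> Y) (g : Y -> Z) :
  borel_map f -> borel_map g -> borel_map (g \o f).
Proof. by move=> bf bg B bB; rewrite comp_preimage; apply: bf; exact: bg. Qed.

(** The sets [B n] may be empty, so that the empty space has a countable base. *)
Definition countable_base (T : topologicalType) (B : (set T)^nat) : Prop :=
  (forall n, open (B n)) /\
  forall (x : T) (U : set T), nbhs x U -> exists2 n, B n x & B n `<=` U.

Section borel_pair.
Context {Y Y' : topologicalType} {B : (set Y)^nat} {B' : (set Y')^nat}.
Hypotheses (cB : countable_base B) (cB' : countable_base B').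

Lemma open_prod_rectangles (U : set (Y * Y')) : open U ->
  U = \bigcup_(n in [set n : nat * nat | B n.1 `*` B' n.2 `<=` U])
        (B n.1 `*` B' n.2).
Proof.
move=> oU; apply/seteqP; split=> [[y y'] Uy|z [n /= nU zn]]; last exact: nU.
have [[P Q] /= [Py Qy'] PQU] : nbhs (y, y') U by exact: open_nbhs_nbhs.
have [n Bn BP] := cB.2 _ _ Py; have [m Bm BQ] := cB'.2 _ _ Qy'.
by exists (n, m) => //= -[z z'] [/= /BP ? /BQ ?]; exact: PQU.
Qed.

Lemma borel_map_pair (X : topologicalType) (f : X -> Y) (g : X -> Y') :
  borel_map f -> borel_map g -> borel_map (fun x => (f x, g x)).
Proof.
move=> bf bg; apply: borel_map_open => U /open_prod_rectangles ->.
rewrite preimage_bigcup; apply: borel_bigcup => [|n _]; first exact: countableP.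
apply: (@borelI _ (f @^-1` B n.1) (g @^-1` B' n.2)).
- by apply: bf; apply: borel_open; exact: cB.1.
- by apply: bg; apply: borel_open; exact: cB'.1.
Qed.

End borel_pair.

Lemma fst_continuous (X Y : topologicalType) : continuous (@fst X Y).
Proof. by move=> x; exact: cvg_fst. Qed.

Lemma snd_continuous (X Y : topologicalType) : continuous (@snd X Y).
Proof. by move=> x; exact: cvg_snd. Qed.

Lemma pair_continuous (X Y Z : topologicalType) (f : X -> Y) (g : X -> Z) :
  continuous f -> continuous g -> continuous (fun x => (f x, g x)).
Proof. by move=> cf cg x; apply: cvg_pair; [exact: cf|exact: cg]. Qed.

Lemma comp_continuous (X Y Z : topologicalType) (f : X -> Y) (g : Y -> Z) :
  continuous f -> continuous g -> continuous (fun x => g (f x)).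
Proof. by move=> cf cg x; apply: continuous_comp; [exact: cf|exact: cg]. Qed.

(** In a Hausdorff space [f x = y] holds as soon as [f x] lies in every base element
    around [y], which expresses the graph by countably many Borel conditions. *)
Lemma borel_graph (X Y : topologicalType) (B : (set Y)^nat) (f : X -> Y) :
  hausdorff_space Y -> countable_base B -> borel_map f ->
  borel [set z : X * Y | f z.1 = z.2].
Proof.
move=> hY cB bf.
have -> : [set z : X * Y | f z.1 = z.2] =
    \bigcap_n ((fst @^-1` (f @^-1` B n)) `|` (snd @^-1` (~` B n))).
  apply/seteqP; split=> [[x y] /= fxy n _|[x y] /= xy].
    by have [?|?] := pselect (B n y); [left; rewrite /= fxy|right].
  apply: contrapT => /eqP; rewrite eq_sym => /(hausdorff_accessible hY)[P [oP]].
  rewrite !inE => /= Py nPfx.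
  have [n By BP] := cB.2 _ _ (open_nbhs_nbhs (conj oP Py)).
  by have [/= /BP|/= ] := xy n I.
apply: borel_bigcap => // n _; apply: borelU.
- apply: (continuous_borel_map (@fst_continuous _ _)); apply: bf.
  by apply: borel_open; exact: cB.1.
- apply: (continuous_borel_map (@snd_continuous _ _)).
  by apply: borelC; apply: borel_open; exact: cB.1.
Qed.

(** * Polish spaces *)

Section polish_distance.
Context {R : realType} {X : topologicalType}.

Lemma polish_dist : polish R X -> exists dist : X -> X -> R,
  [/\ forall x, dist x x = 0, forall x y, dist x y = dist y x,
      forall y x z, dist x z <= dist x y + dist y z,
      forall x U, nbhs x U <->
        exists2 e, 0 < e & forall y, dist x y < e -> U y &
      forall F : set_system X, ProperFilter F ->
        (forall e, 0 < e -> exists x, F [set y | dist x y < e]) ->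
        exists l : X, F --> l].
Proof.
move=> [_ [M cM [f [g [cf cg fK gK]]]]].
exists (fun x y => mdist (f x) (f y)); split.
- by move=> x; rewrite mdistxx.
- by move=> x y; rewrite metric_sym.
- by move=> y x z; exact: metric_triangle.
- move=> x U; split=> [xU|[e e0 eU]].
    have : nbhs (f x) (g @^-1` U) by apply: cg; rewrite fK.
    rewrite -nbhs_ballE => -[e /= e0 eU]; exists e => // y xy.
    by rewrite -(fK y); apply: eU; rewrite ballEmdist.
  have /cf : nbhs (f x) (ball (f x) e) by exact: nbhsx_ballx.
  rewrite /nbhs /= /fmap /=; apply: filterS => y.
  by rewrite /= ballEmdist; exact: eU.
- move=> F PF Fe.
  have [l fFl] : exists l : M, f @ F --> l.
    apply: cM; apply: cauchy_exP => e /Fe[x Fx]; exists (f x).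
    by rewrite ballEmdist; exact: Fx.
  exists (g l) => U /cg /fFl; rewrite /= /nbhs /= /fmap /=.
  by apply: filterS => x /=; rewrite fK.
Qed.

Lemma polish_hausdorff : polish R X -> hausdorff_space X.
Proof.
move=> [_ [M _ [f [g [cf _ fK _]]]]] x y xy; rewrite -(fK x) -(fK y); congr g.
apply: (@metric_hausdorff _ M) => P Q /cf fP /cf fQ.
by have [z [? ?]] := xy _ _ fP fQ; exists (f z).
Qed.

Lemma polish_regular : polish R X -> regular_space X.
Proof.
move=> /polish_dist[dist [d0 ds dt dn _]] x U /dn[e e0 eU].
exists [set y | dist x y < e / 2].
  by apply/dn; exists (e / 2) => //; rewrite divr_gt0.
move=> y cy; apply: eU.
have [|z [/= xz yz]] := cy [set z | dist y z < e / 2].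
  by apply/dn; exists (e / 2) => //; rewrite divr_gt0.
by rewrite (le_lt_trans (dt z _ _))// (splitr e) ltrD// ds.
Qed.

End polish_distance.

(** Complete sequences of countable covers, in the sense of Frolik.  A filter
    that picks a member of every cover plays the role of a Cauchy filter, so
    that completeness can be used and transferred without any metric. *)
Definition complete_cover (T : topologicalType) (A : set T) (N J : Type)
    (U : N -> J -> set T) : Prop :=
  [/\ forall n i, borel (U n i), forall n, A `<=` \bigcup_i U n i &
      forall F : set_system T, ProperFilter F -> F A ->
        (forall n, exists i, F (U n i)) -> exists2 p, A p & F --> p].

Definition has_complete_cover (T : topologicalType) (A : set T) : Prop :=
  exists U : nat -> nat -> set T, complete_cover A U.

Lemma complete_cover_countType (T : topologicalType) (A : set T)
    (N J : countType) (U : N -> J -> set T) :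
  complete_cover A U -> has_complete_cover A.
Proof.
move=> [bU AU cU].
exists (fun n i => if unpickle n is Some m then
                if unpickle i is Some j then U m j else set0 else setT).
split=> [n i|n x Ax|F PF FA FU].
- case: (unpickle n) => [m|]; last exact: borelT.
  by case: (unpickle i) => [j|]; [exact: bU|exact: borel0].
- case E: (unpickle n) => [m|]; last by exists 0%N.
  by have [j _ Uj] := AU m x Ax; exists (pickle j); rewrite // pickleK.
- apply: cU => // m; have [i] := FU (pickle m); rewrite pickleK.
  by case: (unpickle i) => [j|/filter_not_empty//]; exists j.
Qed.

Section polish_countability.
Context {R : realType} {X : topologicalType}.
Hypothesis polX : polish R X.

(** Each [d n] is empty or a singleton, the former only if the space is empty. *)
Lemma polish_dense_seq :
  exists d : nat -> set X, (forall n x y, d n x -> d n y -> x = y) /\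
  forall O : set X, O !=set0 -> open O -> exists n x, d n x /\ O x.
Proof.
have [[D cD dD] _] := polX.
move: cD => /pfcard_geP[D0|/unsquash s].
  exists (fun=> set0); split=> // O O0 /(dD _ O0).
  by rewrite D0 setI0 => -[].
exists (fun n => [set s n]); split=> [n x y -> ->//|O O0 /(dD _ O0)[x [Ox Dx]]].
have [n _ sn] := @surj _ _ _ _ s x Dx.
by exists n, x; split.
Qed.

(** Base and completeness in one: [B n] consists of the balls of radius [1 / n.+1]
    around the points of a dense sequence. *)
Lemma polish_base_covers : exists2 B : nat -> nat -> set X,
  (forall n i, open (B n i)) /\
  (forall x U n0, nbhs x U ->
     exists n i, [/\ (n0 <= n)%N, B n i x & B n i `<=` U]) &
  forall F : set_system X, ProperFilter F ->
    (forall n0, exists n i, (n0 <= n)%N /\ F (B n i)) -> exists p : X, F --> p.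
Proof.
have [dist [d0 ds dt dn dc]] := polish_dist polX.
have [d [d1 dD]] := polish_dense_seq.
have dO x (e : R) : open [set y | dist x y < e].
  rewrite openE => y /= xy; apply/dn; exists (e - dist x y); first by rewrite subr_gt0.
  by move=> z yz /=; rewrite (le_lt_trans (dt y _ _))// -ltrBrDl.
exists (fun n i => \bigcup_(x in d i) [set y | dist x y < n.+1%:R^-1]).
  split=> [n i|x U n0 /dn[e e0 eU]]; first by apply: bigcup_open => x _.
  have e20 : 0 < e / 2 by rewrite divr_gt0.
  near \oo => n.
  have ne : n.+1%:R^-1 < e / 2.
    by near: n; exact: (near_infty_natSinv_lt (PosNum e20)).
  have [|i [y [dy xy]]] := dD [set y | dist x y < n.+1%:R^-1] _ (dO _ _).
    by exists x => /=; rewrite d0 invr_gt0.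
  exists n, i; split; first by near: n; exact: nbhs_infty_ge.
    by exists y => //=; rewrite ds.
  move=> z [y' dy' /=]; rewrite -(d1 _ _ _ dy dy') => yz; apply: eU.
  by rewrite (le_lt_trans (dt y _ _))// (splitr e) ltrD//; exact: lt_trans ne.
move=> F PF FB; apply: dc => // e e0.
near \oo => n0; have [n [i [n0n FBi]]] := FB n0.
have [y [x dx _]] := filter_ex FBi; exists x.
apply: filterS FBi => z [x' dx' /=]; rewrite (d1 _ _ _ dx dx') => /lt_trans; apply.
apply: (@le_lt_trans _ _ n0.+1%:R^-1).
  by rewrite lef_pV2 ?posrE// ler_nat ltnS.
by near: n0; exact: (near_infty_natSinv_lt (PosNum e0)).
Unshelve. all: end_near. Qed.

Lemma polish_countable_base : exists B : (set X)^nat, countable_base B.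
Proof.
have [B [oB xB] _] := polish_base_covers.
exists (fun m => if unpickle m is Some n then B n.1 n.2 else set0); split.
  by move=> m; case: unpickle => [n|]; [exact: oB|exact: open0].
move=> x U /(xB x U 0%N)[n [i [_ Bx BU]]].
by exists (pickle (n, i)); rewrite pickleK.
Qed.

(** In a regular second countable space an open set is the union of the closed
    sets obtained from the base elements whose closures it contains. *)
Lemma polish_open_Fsigma (A : set X) : open A ->
  exists2 C : (set X)^nat, forall n, closed (C n) & A = \bigcup_n C n.
Proof.
move=> oA; have [B [oB xB]] := polish_countable_base.
exists (fun n => if `[< closure (B n) `<=` A >] then closure (B n) else set0).
  by move=> n; case: ifP => _; [exact: closed_closure|exact: closed0].
apply/seteqP; split=> [x Ax|x [n _]]; last by case: ifP => // /asboolP; apply.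
have [V Vx VA] := polish_regular polX (open_nbhs_nbhs (conj oA Ax)).
have [n Bx BV] := xB _ _ Vx; exists n => //.
rewrite asboolT; first exact: subset_closure.
exact: subset_trans (closureS BV) VA.
Qed.

Lemma polish_closed_Gdelta (A : set X) : closed A ->
  exists2 O : (set X)^nat, forall n, open (O n) & A = \bigcap_n O n.
Proof.
move=> /closed_openC/polish_open_Fsigma[C cC AC]; exists (fun n => ~` C n).
  by move=> n; exact/closed_openC.
by rewrite -[A]setCK AC setC_bigcup.
Qed.

(** Covering by base elements whose closures stay inside the open set keeps the
    limits inside. *)
Lemma open_has_complete_cover (A : set X) : open A -> has_complete_cover A.
Proof.
move=> oA; have [B [oB xB] cB] := polish_base_covers.
apply: (@complete_cover_countType _ _ nat (nat * nat)%type (fun n0 m =>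
  if (n0 <= m.1)%N && `[< closure (B m.1 m.2) `<=` A >] then B m.1 m.2 else set0)).
split=> [n [m i]|n x Ax|F PF FA FB].
- by case: ifP => _; [apply: borel_open; exact: oB|exact: borel0].
- have [V Vx VA] := polish_regular polX (open_nbhs_nbhs (conj oA Ax)).
  have [m [i [nm Bx BV]]] := xB _ _ n Vx; exists (m, i) => //=.
  by rewrite nm asboolT//; exact: subset_trans (closureS BV) VA.
- have [n0|p Fp] := cB F PF.
    have [[m i] /=] := FB n0.
    by case: ifP => [/andP[n0m _] FBi|_ /filter_not_empty//]; exists m, i.
  exists p => //; have [[m i] /=] := FB 0%N.
  case: ifP => [/asboolP BA FBi|_ /filter_not_empty//]; apply: BA => V /Fp FV.
  exact: filter_ex (filterI FBi FV).
Qed.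

(** All the covers of all the sets together are complete: the limits of a filter
    found in the different sets agree, because the space is Hausdorff. *)
Lemma bigcap_has_complete_cover (F : (set X)^nat) :
  (forall n, has_complete_cover (F n)) -> has_complete_cover (\bigcap_n F n).
Proof.
move=> /choice[U cU].
apply: (@complete_cover_countType _ _ (nat * nat)%type nat (fun n => U n.1 n.2)).
split=> [n i|n x Fx|G PG GF GU].
- by have [bU _ _] := cU n.1; exact: bU.
- by have [_ FU _] := cU n.1; apply: FU; exact: Fx.
- have lim_in n : exists2 p, F n p & G --> p.
    have [_ _ cF] := cU n; apply: cF => [|m]; last exact: (GU (n, m)).
    by apply: filterS GF; exact: bigcap_inf.
  have [p _ Gp] := lim_in 0%N; exists p => // n _.
  have [q Fq Gq] := lim_in n.
  by rewrite (cvg_unique (polish_hausdorff polX) Gp Gq).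
Qed.

(** Disjointness matters: it forces the members picked by a filter at the
    different levels to come from one and the same piece. *)
Lemma bigcup_has_complete_cover (F : (set X)^nat) :
  trivIset setT F -> (forall n, borel (F n)) ->
  (forall n, has_complete_cover (F n)) -> has_complete_cover (\bigcup_n F n).
Proof.
move=> tF bF /choice[U cU].
apply: (@complete_cover_countType _ _ nat (nat * nat)%type
  (fun n k => F k.1 `&` U k.1 n k.2)).
split=> [n k|n x [k _ Fx]|G PG GF GU].
- by have [bU _ _] := cU k.1; apply: borelI; [exact: bF|exact: bU].
- have [_ FU _] := cU k; have [i _ Ui] := FU n x Fx.
  by exists (k, i).
- have [[k i0] /= Gk] := GU 0%N.
  have GFk : G (F k) by apply: filterS Gk; exact: subIsetl.
  have [_ _ cF] := cU k.
  have [|p Fp Gp] := cF G PG GFk; last by exists p => //; exists k.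
  move=> n; have [[k' i] /= Gk'] := GU n; exists i.
  have [x [[Fx _] Fkx]] := filter_ex (filterI Gk' GFk).
  have kk' : k' = k by apply: (tF k' k I I); exists x.
  by rewrite -kk'; apply: filterS Gk'; exact: subIsetr.
Qed.

(** The sets that have a complete cover together with their complements form a
    sigma-algebra: to take a union, make it disjoint first. *)
Theorem borel_has_complete_cover (A : set X) : borel A -> has_complete_cover A.
Proof.
move=> bA; suff [] : [/\ borel A, has_complete_cover A & has_complete_cover (~` A)] by [].
apply: (borel_ind (P := fun A =>
  [/\ borel A, has_complete_cover A & has_complete_cover (~` A)])) bA => {A}.
- move=> A oA; split; [exact: borel_open|exact: open_has_complete_cover|].
  have [V oV ->] := polish_closed_Gdelta (open_closedC oA).
  by apply: bigcap_has_complete_cover => n; exact: open_has_complete_cover.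
- by move=> A [bA cA cA']; split; rewrite ?setCK//; exact: borelC.
move=> F cF; split.
- by apply: borel_bigcup_nat => n; case: (cF n).
- have DE n : seqDU F n = \bigcap_j (if (j < n)%N then ~` F j else F n).
    rewrite /seqDU setDE -bigcup_mkord setC_bigcup; apply/seteqP; split=> x.
      by move=> [Fx nFx] j _; case: ifPn => // jn; exact: nFx.
    move=> Fx; split; first by have := Fx n I; rewrite ltnn.
    by move=> j /= jn; have := Fx j I; rewrite jn.
  rewrite seqDU_bigcup_eq; apply: bigcup_has_complete_cover.
  + exact: trivIset_seqDU.
  + move=> n; rewrite DE; apply: borel_bigcap => // j _.
    by case: ifP => _; [apply: borelC|]; case: (cF j) => //; case: (cF n).
  + move=> n; rewrite DE; apply: bigcap_has_complete_cover => j.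
    by case: ifP => _; [case: (cF j)|case: (cF n)].
- rewrite setC_bigcup; apply: bigcap_has_complete_cover => n.
  by case: (cF n).
Qed.

End polish_countability.

(** * Branches of a complete cover *)

Lemma history_choice (T : Type) (Q : seq T -> T -> Prop) :
  (forall s, exists v, Q s v) ->
  exists f : nat -> T, forall n, Q (mkseq f n) (f n).
Proof.
move=> /choice[next nextP].
pose fix st n := if n is m.+1 then rcons (st m) (next (st m)) else [::].
exists (fun n => next (st n)) => n.
suff -> : mkseq (fun n => next (st n)) n = st n by [].
by elim: n => // n IH; rewrite mkseqS IH.
Qed.

Lemma tree_branch (T : Type) (P : seq T -> Prop) : P [::] ->
  (forall s, P s -> exists i, P (rcons s i)) ->
  exists a : nat -> T, forall n, P (mkseq a n).
Proof.
move=> P0 PS; have [i0 _] := PS _ P0.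
have [s|a aP] := @history_choice T (fun s i => P s -> P (rcons s i)).
  by have [/PS[i ?]|nPs] := pselect (P s); [exists i|exists i0].
by exists a; elim=> // n /aP; rewrite mkseqS.
Qed.

(** A node of the tree that successive choices of members of the covers
    [U 0], [U 1] and so on generate.  The default value of [nth] is never read. *)
Definition node (T : Type) (A : set T) (U : nat -> nat -> set T) (s : seq nat) :=
  A `&` [set x | forall j, (j < size s)%N -> U j (nth 0%N s j) x].

Section nodes.
Context {T : topologicalType} {A : set T} {U : nat -> nat -> set T}.

Lemma node_nil : node A U [::] = A.
Proof. by apply/seteqP; split=> x; [case|split]. Qed.

Lemma node_sub s : node A U s `<=` A. Proof. by move=> x []. Qed.

Lemma node_mkseqP a n x :
  node A U (mkseq a n) x <-> A x /\ forall j, (j < n)%N -> U j (a j) x.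
Proof.
split=> -[Ax Ux]; split=> // j; last first.
  by rewrite /= size_mkseq => jn; rewrite nth_mkseq//; exact: Ux.
by move=> jn; have := Ux j; rewrite size_mkseq nth_mkseq//; exact.
Qed.

Lemma node_mkseq_sub a m n : (m <= n)%N ->
  node A U (mkseq a n) `<=` node A U (mkseq a m).
Proof.
move=> mn x /node_mkseqP[Ax Ux]; apply/node_mkseqP; split=> // j jm.
exact/Ux/(leq_trans jm).
Qed.

Lemma node_rcons_sub s i : node A U (rcons s i) `<=` node A U s.
Proof.
move=> x [Ax Ux]; split=> // j js; have := Ux j.
by rewrite size_rcons nth_rcons js; apply; exact: ltnW.
Qed.

Lemma node_rcons_cover s x : (A `<=` \bigcup_i U (size s) i) ->
  node A U s x -> exists i, node A U (rcons s i) x.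
Proof.
move=> AU [Ax Ux]; have [i _ Ui] := AU x Ax; exists i; split=> // j.
rewrite /= size_rcons ltnS leq_eqVlt nth_rcons => /predU1P[->|js].
  by rewrite ltnn eqxx.
by rewrite js; exact: Ux.
Qed.

Lemma borel_node s : borel A -> (forall n i, borel (U n i)) ->
  borel (node A U s).
Proof.
move=> bA bU; apply: borelI => //.
by apply: (borel_bigcap (D := [set j | (j < size s)%N])) => //; exact: countableP.
Qed.

(** The nodes along a branch generate a filter that picks a member of every cover. *)
Lemma complete_cover_branch (a : nat -> nat) : complete_cover A U ->
  (forall n, node A U (mkseq a n) !=set0) ->
  exists2 p, A p & forall V, nbhs p V -> exists n, node A U (mkseq a n) `<=` V.
Proof.
move=> [_ _ cU] a0; pose F := filter_from setT (fun n => node A U (mkseq a n)).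
have FF : Filter F.
  apply: filter_from_filter; first by exists 0%N.
  move=> m n _ _; exists (maxn m n) => // x ax.
  by split; apply: node_mkseq_sub ax; rewrite ?leq_maxl ?leq_maxr.
have PF : ProperFilter F by apply: filter_from_proper.
have [||p Ap Fp] := cU F PF.
- by exists 0%N => // x /node_sub.
- by move=> n; exists (a n), n.+1 => // x /node_mkseqP[_]; exact.
- by exists p => // V /Fp[n _ ?]; exists n.
Qed.

(** Late nodes lie in any given neighbourhood of the limit, and neighbourhoods of
    distinct points of a Hausdorff space can be chosen disjoint: hence no point
    other than the image of the limit adheres to the images of all nodes. *)
Lemma branch_adherent (Y : topologicalType) (pi : T -> Y) (a : nat -> nat) p y :
  hausdorff_space Y -> {for p, continuous pi} ->
  (forall V, nbhs p V -> exists n, node A U (mkseq a n) `<=` V) ->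
  (forall n, closure (pi @` node A U (mkseq a n)) y) -> y = pi p.
Proof.
move=> hY cpi pV cy; apply: hY => P Q Py /cpi/pV[n nQ].
have [_ [[x nx <-] Px]] := cy n P Py.
by exists (pi x); split=> //; exact: nQ.
Qed.

End nodes.

(** * Images of Borel sets: separation and injective maps *)

(** If two Borel sets had inseparable images, one could descend along two
    branches of nodes with inseparable images.  The images of the two limits
    are distinct, so disjoint open sets separate the images of two late nodes. *)
Theorem image_separation (R : realType) (T Y : topologicalType) (pi : T -> Y)
    (A B : set T) : polish R T -> hausdorff_space Y -> continuous pi ->
  borel A -> borel B -> pi @` A `&` pi @` B = set0 ->
  exists2 S, borel S & pi @` A `<=` S /\ S `&` pi @` B = set0.
Proof.
move=> pT hY cpi bA bB AB.
have [U cU] := borel_has_complete_cover pT bA.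
have [V cV] := borel_has_complete_cover pT bB.
pose sep (C D : set T) := exists2 S, borel S & pi @` C `<=` S /\ S `&` pi @` D = set0.
suff : sep (node A U [::]) (node B V [::]) by rewrite !node_nil.
apply: contrapT => nsep.
pose s1 := map (@fst nat nat); pose s2 := map (@snd nat nat).
have [|s|ab nab] := @tree_branch _ (fun s => ~ sep (node A U (s1 s)) (node B V (s2 s))).
- exact: nsep.
- move=> ns; apply: contrapT => /forallNP sepS; apply: ns.
  have /choice[S SP] : forall ij : nat * nat, exists S, borel S /\
      (pi @` node A U (rcons (s1 s) ij.1) `<=` S /\
       S `&` pi @` node B V (rcons (s2 s) ij.2) = set0).
    move=> ij; have /contrapT := sepS ij; rewrite /s1 /s2 !map_rcons.
    by move=> [S ? ?]; exists S.
  have [_ AU _] := cU; have [_ BV _] := cV.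
  exists (\bigcup_i \bigcap_j S (i, j)).
    apply: borel_bigcup_nat => i; apply: borel_bigcap => // j _.
    by have [] := SP (i, j).
  split=> [_ [x nx <-]|].
    have [i nix] := node_rcons_cover (AU _) nx; exists i => // j _.
    by have [_ [+ _]] := SP (i, j); apply; exists x.
  rewrite -subset0 => y [[i _ Sij] [x nx xy]].
  have [j njx] := node_rcons_cover (BV _) nx.
  have [_ [_ S0]] := SP (i, j).
  suff : (S (i, j) `&` pi @` node B V (rcons (s2 s) j)) y by rewrite S0.
  by split; [exact: Sij|exists x].
pose a n := (ab n).1; pose b n := (ab n).2.
have nabE n : ~ sep (node A U (mkseq a n)) (node B V (mkseq b n)).
  by have := nab n; rewrite /s1 /s2 /mkseq -!map_comp.
have [n|p Ap pA] := complete_cover_branch (a := a) cU.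
  apply/set0P/eqP => n0; apply: (nabE n); rewrite /sep n0 image_set0.
  by exists set0; [exact: borel0|split=> //; exact: set0I].
have [n|q Bq qB] := complete_cover_branch (a := b) cV.
  apply/set0P/eqP => n0; apply: (nabE n); rewrite /sep n0 image_set0.
  by exists setT; [exact: borelT|split=> //; exact: setI0].
have pq : pi p != pi q.
  apply/eqP => pq; rewrite -[False]/(set0 (pi p)) -AB.
  by split; [exists p|exists q].
move: hY; rewrite open_hausdorff => /(_ _ _ pq)[[P Q] /= [Pp Qq] [oP oQ PQ]].
rewrite !inE in Pp Qq.
have [m mP] := pA _ (cpi p _ (open_nbhs_nbhs (conj oP Pp))).
have [n nQ] := qB _ (cpi q _ (open_nbhs_nbhs (conj oQ Qq))).
apply: (nabE (maxn m n)); exists P; first exact: borel_open.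
split=> [_ [x nx <-]|]; first by apply/mP/(node_mkseq_sub (leq_maxl m n)).
rewrite -subset0 => y [Py [x nx xy]]; rewrite -(eqP PQ); split=> //.
by rewrite -xy; apply/nQ/(node_mkseq_sub (leq_maxr m n)).
Qed.

Lemma disjoint_cover (T : topologicalType) (A : set T) : has_complete_cover A ->
  exists2 U : nat -> nat -> set T, complete_cover A U &
    forall n i j x, U n i x -> U n j x -> i = j.
Proof.
move=> [U [bU AU cU]]; exists (fun n => seqDU (U n)).
  split=> [n i|n|F PF FA FU].
  - rewrite /seqDU -bigcup_mkord; apply: borelD => //.
    by apply: borel_bigcup => //; exact: countableP.
  - by rewrite -seqDU_bigcup_eq; exact: AU.
  - apply: cU => // n; have [i Fi] := FU n; exists i.
    by apply: filterS Fi; exact: subDsetl.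
move=> n i j x Ui Uj; apply: (trivIset_seqDU (U n)) => //.
by exists x.
Qed.

(** Separating the images of the members of each disjoint cover turns the
    branch through a point of the image into a Borel function of that point,
    and the point is recovered as the limit of the branch. *)
Theorem injective_continuous_image (R : realType) (T Y : topologicalType)
    (pi : T -> Y) (A : set T) : polish R T -> polish R Y -> continuous pi ->
  borel A -> {in A &, injective pi} -> borel (pi @` A).
Proof.
move=> pT pY cpi bA injpi.
have [U cU disU] := disjoint_cover (borel_has_complete_cover pT bA).
have hY := polish_hausdorff pY.
have [bU AU _] := cU.
have sepN n i j : exists S, borel S /\ (i != j ->
    pi @` (A `&` U n i) `<=` S /\ S `&` pi @` (A `&` U n j) = set0).
  have [<-|ij] := eqVneq i j; first by exists set0; split => //; exact: borel0.
  have UiUj : pi @` (A `&` U n i) `&` pi @` (A `&` U n j) = set0.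
    rewrite -subset0 => y [[x [Ax Ux] <-] [z [Az Uz] zx]].
    have xz : z = x by apply: injpi; rewrite ?inE.
    by case/eqP: ij; apply: (disU n i j x) => //; rewrite -xz.
  have [S bS S12] := image_separation pT hY cpi (borelI bA (bU n i))
    (borelI bA (bU n j)) UiUj.
  by exists S.
have {sepN}/choice[S SP] : forall k : nat * nat * nat, exists S, borel S /\
    (k.1.2 != k.2 -> pi @` (A `&` U k.1.1 k.1.2) `<=` S /\
       S `&` pi @` (A `&` U k.1.1 k.2) = set0).
  by move=> [[n i] j]; exact: sepN.
(* Subtracting the separating sets from each other makes the Borel sets [B n i]
   around the images disjoint for distinct [i]. *)
pose B (n i : nat) := \bigcap_(j in [set j | i != j]) (S (n, i, j) `\` S (n, j, i)).
have bB n i : borel (B n i).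
  apply: borel_bigcap => [|j _]; first exact: countableP.
  by apply: borelD; have [] := SP (n, i, j); have [] := SP (n, j, i).
have subB n i : pi @` (A `&` U n i) `<=` B n i.
  move=> y Uy j /= ij; split; first by have [_ /(_ ij)[+ _]] := SP (n, i, j); exact.
  move=> Sy; have [_ /= ] := SP (n, j, i); rewrite eq_sym => /(_ ij)[_ S0].
  by rewrite -[False]/(set0 y) -S0; split.
have disB n i j y : B n i y -> B n j y -> i = j.
  move=> Bi Bj; apply: contrapT => /eqP ij.
  have [_ nS] := Bi j ij; apply: nS.
  by have [|] := Bj i; rewrite //= eq_sym.
pose Q s := closure (pi @` node A U s) `&`
  \bigcap_(j in [set j | (j < size s)%N]) B j (nth 0%N s j).
have -> : pi @` A = \bigcap_n \bigcup_(s in [set s | size s = n]) Q s.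
  apply/seteqP; split=> [_ [x Ax <-] n _|y Qy].
    have /choice[a ax] : forall n, exists i, U n i x.
      by move=> m; have [i _ ?] := AU m x Ax; exists i.
    exists (mkseq a n); first by rewrite /= size_mkseq.
    split=> [|j /=]; last first.
      by rewrite size_mkseq => jn; rewrite nth_mkseq//; apply: subB; exists x.
    by apply: subset_closure; exists x => //; exact/node_mkseqP.
  have /choice[a aP] : forall n, exists i, B n i y.
    move=> n; have [s /= sn [_ Bs]] := Qy n.+1 I.
    by exists (nth 0%N s n); apply: Bs => /=; rewrite sn.
  have Qa n : Q (mkseq a n) y.
    have [s /= sn Qs] := Qy n I; suff <- : s = mkseq a n by [].
    apply: (@eq_from_nth _ 0%N) => [|j js]; first by rewrite size_mkseq.
    rewrite nth_mkseq -?sn//; apply: disB (aP j).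
    by have [_] := Qs; apply.
  have [n|p Ap pA] := complete_cover_branch (a := a) cU.
    have [/(_ setT filterT) [_ [[x nx _] _]] _] := Qa n.
    by exists x.
  exists p => //; apply/esym; apply: (branch_adherent hY (cpi p) pA) => n.
  by have [] := Qa n.
apply: borel_bigcap => // n _; apply: borel_bigcup => [|s _]; first exact: countableP.
apply: borelI; first by apply: borel_closed; exact: closed_closure.
by apply: borel_bigcap => //; exact: countableP.
Qed.

(** * Polish constructions *)

Section homeomorphism.
Context {X Y : topologicalType}.

Lemma cluster_continuous (f : X -> Y) x y : continuous f ->
  cluster (nbhs x) y -> cluster (nbhs (f x)) (f y).
Proof.
move=> cf xy P Q /cf fP /cf fQ.
by have [z [? ?]] := xy _ _ fP fQ; exists (f z).
Qed.

Lemma homeomorphic_sym : homeomorphic X Y -> homeomorphic Y X.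
Proof. by move=> [f [g [cf cg fK gK]]]; exists g, f. Qed.

Lemma separable_homeomorphic : homeomorphic X Y -> separable X -> separable Y.
Proof.
move=> [f [g [cf cg fK gK]]] [D cD dD]; exists (f @` D).
  exact: sub_countable (card_image_le _ _) cD.
move=> O [y Oy] oO; have [|x [Ofx Dx]] := dD (f @^-1` O) _ (open_comp (fun x _ => cf x) oO).
  by exists (g y); rewrite /= gK.
by exists (f x); split => //; exists x.
Qed.

Lemma homeomorphic_trans (Z : topologicalType) :
  homeomorphic X Y -> homeomorphic Y Z -> homeomorphic X Z.
Proof.
move=> [f [g [cf cg fK gK]]] [f' [g' [cf' cg' fK' gK']]].
exists (f' \o f), (g \o g'); split.
- by move=> x; apply: continuous_comp; [exact: cf|exact: cf'].
- by move=> x; apply: continuous_comp; [exact: cg'|exact: cg].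
- by move=> x /=; rewrite fK' fK.
- by move=> x /=; rewrite gK gK'.
Qed.

End homeomorphism.

Lemma polish_homeomorphic (R : realType) (X Y : topologicalType) :
  homeomorphic X Y -> polish R Y -> polish R X.
Proof.
move=> XY [sY [M cM YM]]; split.
  exact: separable_homeomorphic (homeomorphic_sym XY) sY.
by exists M => //; exact: homeomorphic_trans YM.
Qed.

(** The distance that a pseudometric structure, given by its balls alone, yields
    on a Hausdorff space.  Truncating at [1] keeps it finite. *)
Section truncated_distance.
Context {R : realType} {T : pseudoMetricType R}.
Implicit Types x y z : T.

Definition ball_radii x y : set R := [set e | 0 < e /\ ball x e y] `|` [set 1].
Definition trunc_dist x y : R := inf (ball_radii x y).

Let radii_gt0 x y e : ball_radii x y e -> 0 < e.
Proof. by move=> [[]//|->]. Qed.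

Let has_inf_radii x y : has_inf (ball_radii x y).
Proof.
split; first by exists 1; right.
by exists 0 => e /radii_gt0/ltW.
Qed.

Let trunc_dist_le_radii x y e : ball_radii x y e -> trunc_dist x y <= e.
Proof. by apply: ge_inf; case: (has_inf_radii x y). Qed.

Let trunc_dist_lt_radii x y e : trunc_dist x y < e ->
  exists2 r, ball_radii x y r & r < e.
Proof. by move=> /(inf_lt (has_inf_radii x y).1)[r ? ?]; exists r. Qed.

Lemma trunc_dist_le x y e : 0 < e -> ball x e y -> trunc_dist x y <= e.
Proof. by move=> e0 xye; apply: trunc_dist_le_radii; left. Qed.

Lemma trunc_dist_lt_ball x y e : e <= 1 -> trunc_dist x y < e -> ball x e y.
Proof.
move=> e1 /trunc_dist_lt_radii[r [[r0 xyr]|->] re].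
  exact: le_ball (ltW re) _ xyr.
by move: re; rewrite ltNge e1.
Qed.

Lemma trunc_dist_ge0 x y : 0 <= trunc_dist x y.
Proof.
by apply: lb_le_inf; [exists 1; right|move=> e /radii_gt0/ltW].
Qed.

Lemma trunc_distxx x : trunc_dist x x = 0.
Proof.
apply/eqP; rewrite eq_le trunc_dist_ge0 andbT; apply/ler_addgt0Pl => e e0.
by rewrite addr0; apply: trunc_dist_le => //; exact: ballxx.
Qed.

Lemma trunc_dist_eq0 : hausdorff_space T ->
  forall x y, trunc_dist x y = 0 -> x = y.
Proof.
move=> hT x y xy0; apply: (close_eq hT); rewrite ball_close => e.
have m0 : 0 < Num.min e%:num 1 by rewrite lt_min ltr01 andbT.
have : ball x (Num.min e%:num 1) y.
  by apply: trunc_dist_lt_ball; rewrite ?xy0// ge_min lexx orbT.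
by apply: le_ball; rewrite ge_min lexx.
Qed.

Lemma trunc_dist_sym x y : trunc_dist x y = trunc_dist y x.
Proof.
rewrite /trunc_dist; congr inf; rewrite /ball_radii; congr (_ `|` _).
by apply/seteqP; split=> e [e0 /ball_sym].
Qed.

Lemma trunc_dist_triangle y x z :
  trunc_dist x z <= trunc_dist x y + trunc_dist y z.
Proof.
apply/ler_addgt0Pl => e e0.
have e20 : 0 < e / 2 by rewrite divr_gt0.
have [r xyr re] := trunc_dist_lt_radii (ltr_pwDl e20 (lexx (trunc_dist x y))).
have [s yzs se] := trunc_dist_lt_radii (ltr_pwDl e20 (lexx (trunc_dist y z))).
rewrite (splitr e) addrACA; apply: (@le_trans _ _ (r + s)); last by rewrite lerD// ltW.
have [r0 s0] := (radii_gt0 xyr, radii_gt0 yzs).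
have dist1 : trunc_dist x z <= 1 by apply: trunc_dist_le_radii; right.
case: xyr => [[_ xyr]|/= r1]; last by apply: le_trans dist1 _; rewrite r1 lerDl ltW.
case: yzs => [[_ yzs]|/= s1]; last by apply: le_trans dist1 _; rewrite s1 lerDr ltW.
by apply: trunc_dist_le; [exact: addr_gt0|exact: ball_triangle yzs].
Qed.

End truncated_distance.

Definition truncated_metric (R : realType) (T : pseudoMetricType R)
  (hT : hausdorff_space T) : Type := T.

HB.instance Definition _ (R : realType) (T : pseudoMetricType R)
  (hT : hausdorff_space T) := Choice.on (truncated_metric hT).

HB.instance Definition _ (R : realType) (T : pseudoMetricType R)
  (hT : hausdorff_space T) :=
  @isMetric.Build R (truncated_metric hT) trunc_dist trunc_distxx
    (trunc_dist_eq0 hT) trunc_dist_sym trunc_dist_triangle.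

Lemma polish_pseudometric (R : realType) (T : pseudoMetricType R) :
  hausdorff_space T -> separable T ->
  (forall F : set_system T, ProperFilter F -> cauchy F -> exists l : T, F --> l) ->
  polish R T.
Proof.
move=> hT sT cT; split=> //.
have min1 (e : R) : 0 < e -> 0 < Num.min e 1 by move=> ?; rewrite lt_min ltr01 andbT.
have ballT (x y : truncated_metric hT) (e : R) :
    ball x (Num.min e 1) y -> ball (x : T) e (y : T).
  rewrite ballEmdist => /trunc_dist_lt_ball xy.
  have : ball (x : T) (Num.min e 1) y by apply: xy; rewrite ge_min lexx orbT.
  by apply: le_ball; rewrite ge_min lexx.
have Tball (x y : T) (e : R) : 0 < e -> ball x (e / 2) y ->
    ball (x : truncated_metric hT) e (y : truncated_metric hT).
  move=> e0 xy; rewrite ballEmdist /=; apply: (@le_lt_trans _ _ (e / 2)).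
    by apply: trunc_dist_le => //; rewrite divr_gt0.
  by rewrite ltr_pdivrMr// ltr_pMr// ltr1n.
have cid1 : continuous (id : T -> truncated_metric hT).
  move=> x U /= /nbhs_ballP[e /= e0 eU]; apply/nbhs_ballP.
  by exists (e / 2) => /= [|y xy]; [rewrite divr_gt0|apply/eU/Tball].
have cid2 : continuous (id : truncated_metric hT -> T).
  move=> x U /= /nbhs_ballP[e /= e0 eU]; apply/nbhs_ballP.
  by exists (Num.min e 1) => /= [|y /ballT/eU//]; exact: min1.
exists (truncated_metric hT); last by exists id, id; split.
move=> F PF cF.
have [l Fl] : exists l : T, F --> l.
  apply: cT => E; rewrite -entourage_ballE => -[e /= e0 eE].
  have /cF : entourage [set xy : truncated_metric hT * truncated_metric hT |
      ball xy.1 (Num.min e 1) xy.2].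
    by rewrite -entourage_ballE; exists (Num.min e 1) => //; exact: min1.
  by apply: (@filterS _ (nbhs (F, F))) => -[x y] /= xy; exact/eE/ballT.
by exists l => U /cid1 /Fl.
Qed.

Lemma separable_net (T : topologicalType) (J : countType) (N : J -> set T) :
  (forall O : set T, O !=set0 -> open O ->
     exists2 i, N i !=set0 & N i `<=` O) -> separable T.
Proof.
move=> netN.
have [[t0]|T0] := pselect (exists t : T, True); last first.
  exists set0; first exact: countable0.
  by move=> O [x _]; case: T0; exists x.
have /choice[d dN] : forall i, exists x, N i !=set0 -> N i x.
  move=> i; have [[x Nx]|?] := pselect (N i !=set0); first by exists x.
  by exists t0.
exists (range d); first by apply: sub_countable (card_image_le _ _) (countableP _).
move=> O O0 /(netN _ O0)[i /dN Ni NO]; exists (d i); split; first exact: NO.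
by exists i.
Qed.

Lemma separable_prod (X Y : topologicalType) :
  separable X -> separable Y -> separable (X * Y)%type.
Proof.
move=> [D cD dD] [D' cD' dD']; exists (D `*` D'); first exact: countableX.
move=> O [[x y] Oxy] oO.
have [[P Q] /= [Px Qy] PQO] : nbhs (x, y) O by exact: open_nbhs_nbhs.
have [|x' [Px' Dx']] := dD P° _ (open_interior P); first by exists x.
have [|y' [Qy' Dy']] := dD' Q° _ (open_interior Q); first by exists y.
by exists (x', y'); split=> //; apply: PQO; split; exact: interior_subset.
Qed.

Lemma compact_finite_cover (T : topologicalType) (K : set T) (f : T -> set T) :
  compact K -> (forall x, K x -> nbhs x (f x)) ->
  exists s : seq T, forall z, K z -> exists2 x, x \in s & f x z.
Proof.
move=> /compact_near_coveringP cK Kf.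
pose F : set_system (seq T) :=
  filter_from setT (fun s0 : seq T => [set s : seq T | {subset s0 <= s}]).
have FF : Filter F.
  apply: filter_from_filter; first by exists [::].
  move=> s t _ _; exists (s ++ t) => // r str.
  by split=> x xs; apply: str; rewrite mem_cat xs ?orbT.
have [|s _ sK] := cK _ F (fun s z => exists2 x, x \in s & f x z) FF.
  move=> x Kx; exists (f x, [set s | x \in s]); last by move=> [z s] [/= ? ?]; exists x.
  split=> /=; first exact: Kf.
  by exists [:: x] => // s; apply; rewrite mem_seq1.
by exists s => z Kz; exact: (sK s).
Qed.

Section polish_instances.
Context (R : realType).

Lemma polish_prod (X Y : topologicalType) :
  polish R X -> polish R Y -> polish R (X * Y)%type.
Proof.
move=> pX pY.
have [sX [M cM [f [g [cf cg fK gK]]]]] := pX.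
have [sY [M' cM' [f' [g' [cf' cg' fK' gK']]]]] := pY.
apply: (@polish_homeomorphic _ _ (M * M')%type).
  exists (fun z => (f z.1, f' z.2)), (fun z => (g z.1, g' z.2)); split.
  - move=> z; apply: cvg_pair.
      by apply: continuous_comp; [exact: cvg_fst|exact: cf].
    by apply: continuous_comp; [exact: cvg_snd|exact: cf'].
  - move=> z; apply: cvg_pair.
      by apply: continuous_comp; [exact: cvg_fst|exact: cg].
    by apply: continuous_comp; [exact: cvg_snd|exact: cg'].
  - by move=> [x y]; rewrite /= fK fK'.
  - by move=> [x y]; rewrite /= gK gK'.
apply: polish_pseudometric.
- move=> z w zw; rewrite (surjective_pairing z) (surjective_pairing w).
  congr (_, _); apply: metric_hausdorff.
    exact: (cluster_continuous (@fst_continuous _ _)).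
  exact: (cluster_continuous (@snd_continuous _ _)).
- apply: separable_prod.
    by apply: separable_homeomorphic sX; exists f, g.
  by apply: separable_homeomorphic sY; exists f', g'.
- move=> F PF cF.
  have [l Fl] : exists l : M, fst @ F --> l.
    apply: cM => E entE.
    have /cF : entourage [set xy : (M * M') * (M * M') | E (xy.1.1, xy.2.1)].
      have := prod_entP entE (@entourageT M').
      by apply: (@filterS _ _ (prod_ent_filter)) => -[[? ?] [? ?]] /= [].
    case=> -[P Q] /= [FP FQ] PQE; exists (fst @` P, fst @` Q) => /=.
      by split; [apply: filterS FP|apply: filterS FQ] => z Pz; exists z.
    by move=> [_ _] /= [[x Px <-] [y Qy <-]]; exact: (PQE (x, y)).
  have [l' Fl'] : exists l : M', snd @ F --> l.
    apply: cM' => E entE.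
    have /cF : entourage [set xy : (M * M') * (M * M') | E (xy.1.2, xy.2.2)].
      have := prod_entP (@entourageT M) entE.
      by apply: (@filterS _ _ (prod_ent_filter)) => -[[? ?] [? ?]] /= [].
    case=> -[P Q] /= [FP FQ] PQE; exists (snd @` P, snd @` Q) => /=.
      by split; [apply: filterS FP|apply: filterS FQ] => z Pz; exists z.
    by move=> [_ _] /= [[x Px <-] [y Qy <-]]; exact: (PQE (x, y)).
  exists (l, l') => U [[P Q] /= [/Fl FP /Fl' FQ] PQU].
  have : F ((fst @^-1` P) `&` (snd @^-1` Q)) by exact: filterI.
  by apply: (@filterS _ F) => -[z z'] [? ?]; exact: PQU.
Qed.

(** A Cauchy filter converges to each of its cluster points. *)
Lemma compact_complete (T : uniformType) : compact [set: T] ->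
  forall F : set_system T, ProperFilter F -> cauchy F -> exists l : T, F --> l.
Proof.
move=> cT F PF cF; have [x [_ clx]] := cT F PF filterT; exists x.
apply/cvg_entourageP => E entE.
have [[P Q] /= [FP FQ] PQE] := cF _ (entourage_split_ent entE).
have [z [Pz /xsectionP xz]] := clx _ _ FP (nbhs_entourage x (entourage_split_ent entE)).
by apply: filterS FQ => y Qy; apply: (entourage_split z) => //; exact: (PQE (z, y)).
Qed.

Lemma compact_separable (T : pseudoMetricType R) :
  compact [set: T] -> separable T.
Proof.
move=> cT.
have /choice[s sP] : forall n : nat, exists s : seq T, forall z : T,
    exists2 x, x \in s & ball x n.+1%:R^-1 z.
  move=> n; have [x _|s sP] := compact_finite_cover (f := fun x => ball x n.+1%:R^-1) cT.
    by apply: nbhsx_ballx; rewrite invr_gt0.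
  by exists s => z; exact: sP.
exists (\bigcup_n [set` s n]).
  by apply: bigcup_countable => // n _; apply: finite_set_countable; exact: finite_seq.
move=> O [x Ox]; rewrite openE => /(_ _ Ox); rewrite /interior -nbhs_ballE => -[e /= e0 eO].
near \oo => n; have [y sy yx] := sP n x.
exists y; split; last by exists n.
apply: eO; apply: ball_sym; apply: le_ball yx; apply: ltW.
by near: n; exact: (near_infty_natSinv_lt (PosNum e0)).
Unshelve. all: end_near. Qed.

Lemma polish_compact (Z : topologicalType) : compact [set: Z] ->
  metrizable R Z -> polish R Z.
Proof.
move=> cZ [M ZM]; have [f [g [cf cg fK gK]]] := ZM.
apply: polish_homeomorphic ZM _.
have cM : compact [set: M].
  have -> : [set: M] = f @` [set: Z].
    by apply/seteqP; split=> // y _; exists (g y).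
  by apply: continuous_compact => //; exact: continuous_subspaceT.
apply: polish_pseudometric.
- exact: metric_hausdorff.
- exact: compact_separable.
- exact: compact_complete.
Qed.

Lemma polish_cantor : polish R cantor_space.
Proof.
apply: (@polish_pseudometric R cantor_space).
- exact: cantor_space_hausdorff.
- exact: (compact_separable cantor_space_compact).
- exact: (compact_complete cantor_space_compact).
Qed.

End polish_instances.

(** * The space of continuous maps *)

Section uniform_maps.
Context {R : realType} {Z : topologicalType} {M : metricType R}.
Hypotheses (cZ : compact [set: Z]) (pZ : polish R Z).
Hypotheses (cM : complete_metric M) (pM : polish R M).

Definition uniform_maps : Type := initial_topology
  (fun k : continuousType Z M => (k : Z -> M) : arrow_uniform_type Z M).

HB.instance Definition _ := PseudoMetric.copy uniform_maps
  (initial_topology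
    (fun k : continuousType Z M => (k : Z -> M) : arrow_uniform_type Z M)).

Let val (k : uniform_maps) : Z -> M := (k : continuousType Z M).

Let val_continuous k : continuous (val k).
Proof. by move=> x; exact: (@cts_fun _ _ (k : continuousType Z M)). Qed.

Lemma uniform_maps_ball (k l : uniform_maps) e :
  ball k e l <-> forall t, ball (val k t) e (val l t).
Proof. by []. Qed.

Lemma uniform_maps_eq (k l : uniform_maps) : val k = val l -> k = l.
Proof. by move=> kl; apply/continuousEP => t; rewrite -[LHS]/(val k t) kl. Qed.

Lemma uniform_maps_hausdorff : hausdorff_space uniform_maps.
Proof.
move=> k l kl; apply: uniform_maps_eq; apply/funext => t.
apply: (@metric_hausdorff _ M) => P Q.
rewrite -!nbhs_ballE => -[e /= e0 eP] [e' /= e0' eQ].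
have [m [km lm]] := kl _ _ (nbhsx_ballx k e e0) (nbhsx_ballx l e' e0').
by exists (val m t); split; [exact/eP/km|exact/eQ/lm].
Qed.

(** Finitely many conditions of the form [k @` B i `<=` B' j], where the [B i]
    cover [Z] and the [B' j] are small, confine [k] to a small ball. *)
Lemma uniform_maps_separable : separable uniform_maps.
Proof.
have [B [oB xB]] := polish_countable_base pZ.
have [B' [oB' xB']] := polish_countable_base pM.
apply: (separable_net (N := fun (p : seq (nat * nat)) =>
  [set k : uniform_maps | forall ij, ij \in p ->
     forall z, B ij.1 z -> B' ij.2 (val k z)])) => O [k Ok].
rewrite openE => /(_ _ Ok); rewrite /interior -nbhs_ballE => -[e /= e0 eO].
have e20 : 0 < e / 2 by rewrite divr_gt0.
have /choice[ij ijP] : forall z, exists ij : nat * nat, [/\ B ij.1 z,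
    forall t, B ij.1 t -> B' ij.2 (val k t) &
    forall y, B' ij.2 y -> ball (val k z) (e / 2) y].
  move=> z; have [j Bj Be] := xB' _ _ (nbhsx_ballx (val k z) _ e20).
  have [|i Bi BB] := xB z (val k @^-1` B' j).
    by apply: val_continuous; apply: open_nbhs_nbhs; split.
  by exists (i, j); split.
have [z _|s sP] := compact_finite_cover (f := fun z => B (ij z).1) cZ.
  by have [Bz _ _] := ijP z; apply: open_nbhs_nbhs; split.
exists (map ij s).
  by exists k => _ /mapP[x sx ->] z; have [_ + _] := ijP x; exact.
move=> l lP; apply: eO; apply/uniform_maps_ball => t; have [x sx Bt] := sP t I.
have [_ kB Be] := ijP x; rewrite (splitr e).
apply: (@ball_triangle _ _ (val k x)); first exact/ball_sym/Be/kB.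
by apply: Be; apply: (lP (ij x)) => //; exact: map_f.
Qed.

Lemma uniform_maps_complete (F : set_system uniform_maps) :
  ProperFilter F -> cauchy F -> exists l : uniform_maps, F --> l.
Proof.
move=> PF cF.
have Fe e : 0 < e -> exists2 P, F P & forall k l, P k -> P l -> ball k e l.
  move=> e0; have [|[P Q] /= [FP FQ] PQ] := cF [set kl | ball kl.1 e kl.2].
    by rewrite -entourage_ballE; exists e.
  exists (P `&` Q); first exact: filterI.
  by move=> k l [Pk _] [_ Ql]; exact: (PQ (k, l)).
have /choice[l lP] : forall t, exists y : M, (fun k => val k t) @ F --> y.
  move=> t; apply: cM => E; rewrite -entourage_ballE => -[e /= e0 eE].
  have [P FP Pe] := Fe e e0; exists ((val ^~ t) @` P, (val ^~ t) @` P) => /=.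
    by split; rewrite /nbhs /=; apply: (@filterS _ F _ P) => // k Pk; exists k.
  by move=> [_ _] [/= [k Pk <-] [m Pm <-]]; apply: eE; exact: Pe.
have Fl e : 0 < e -> exists2 P, F P & forall k t, P k -> ball (l t) e (val k t).
  move=> e0; have e20 : 0 < e / 2 by rewrite divr_gt0.
  have [P FP Pe] := Fe _ e20; exists P => // k t Pk.
  have Ft : F [set m | ball (l t) (e / 2) (val m t)].
    exact: (lP t _ (nbhsx_ballx (l t) _ e20)).
  have [m [Pm lm]] := filter_ex (filterI FP Ft).
  by rewrite (splitr e); apply: ball_triangle lm _; exact: Pe.
have cl : continuous l.
  move=> x U; rewrite /= -nbhs_ballE => -[e /= e0 eU].
  have e20 : 0 < e / 2 by rewrite divr_gt0.
  have e40 : 0 < e / 2 / 2 by rewrite divr_gt0.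
  have [P FP Pl] := Fl _ e40; have [k Pk] := filter_ex FP.
  have /val_continuous := nbhsx_ballx (val k x) _ e20.
  rewrite /nbhs /= /fmap /=; apply: filterS => t kxt; apply: eU.
  rewrite (splitr e) {1}(splitr (e / 2)) -addrA.
  apply: ball_triangle (Pl _ _ Pk) _; rewrite addrC.
  by apply: ball_triangle kxt _; apply: ball_sym; exact: Pl.
exists (mkcts cl : continuousType Z M) => U; rewrite /= -nbhs_ballE => -[e /= e0 eU].
have [P FP Pl] := Fl e e0.
by apply: (@filterS _ F _ P) => // k Pk; apply: eU; apply/uniform_maps_ball => t; exact: Pl.
Qed.

Lemma polish_uniform_maps : polish R uniform_maps.
Proof.
apply: (@polish_pseudometric R uniform_maps).
- exact: uniform_maps_hausdorff.
- exact: uniform_maps_separable.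
- exact: uniform_maps_complete.
Qed.

End uniform_maps.

Section compact_open_maps.
Context {R : realType} {Z X : topologicalType}.
Hypotheses (cZ : compact [set: Z]) (pZ : polish R Z) (pX : polish R X).

Local Notation C := (compact_open_map Z X).

Definition cofun (h : C) : Z -> X := (h : continuousType Z X).

Lemma cofun_continuous (h : C) : continuous (cofun h).
Proof. by move=> z; exact: (@cts_fun _ _ (h : continuousType Z X)). Qed.

Lemma cofun_inj : injective cofun.
Proof. by move=> h k hk; apply/continuousEP => t; rewrite -[LHS]/(cofun h t) hk. Qed.

Lemma compact_open_map_nbhs (h : C) (K : set Z) (O : set X) : compact K ->
  open O -> (forall z, K z -> O (cofun h z)) ->
  nbhs h [set k : C | forall z, K z -> O (cofun k z)].
Proof.
move=> cK oO hKO; apply: open_nbhs_nbhs; split=> //.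
exists [set g : {compact-open, Z -> X} | g @` K `<=` O].
  exact: compact_open_open.
apply/seteqP; split=> k /= kK; first by move=> z Kz; apply: kK; exists z.
by move=> _ [z Kz <-]; exact: kK.
Qed.

(** Both directions are compactness arguments over [Z].  Near a point [x] the maps
    [k] that send a small closed neighbourhood of [x] into a small ball around
    [h x] are close to [h] there, and finitely many such neighbourhoods cover [Z];
    conversely, a small uniform change keeps the image of a compact set inside an
    open set. *)
Lemma compact_open_uniform (M : metricType R) : homeomorphic X M ->
  homeomorphic C (uniform_maps (Z := Z) (M := M)).
Proof.
move=> [f [g [cf cg fK gK]]].
have cfh (h : C) : continuous (f \o cofun h).
  by move=> z; apply: continuous_comp; [exact: cofun_continuous|exact: cf].
pose Phi (h : C) : uniform_maps (Z := Z) (M := M) := (mkcts (cfh h) : continuousType Z M).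
have cgk (k : uniform_maps (Z := Z) (M := M)) : continuous (g \o (k : continuousType Z M)).
  move=> z; apply: continuous_comp; last exact: cg.
  exact: (@cts_fun _ _ (k : continuousType Z M)).
pose Psi k : C := (mkcts (cgk k) : continuousType Z X).
exists Phi, Psi; split.
- move=> h U; rewrite /= -nbhs_ballE => -[e /= e0 eU].
  have e20 : 0 < e / 2 by rewrite divr_gt0.
  apply: (@filterS _ (nbhs h) _ [set k : C | forall z, setT z ->
      ball (f (cofun h z)) e (f (cofun k z))]) => [k kh|].
    by apply: eU; apply/uniform_maps_ball => t; exact: (kh t).
  move: cZ => /compact_near_coveringP/(_ C (nbhs h)
    (fun k z => ball (f (cofun h z)) e (f (cofun k z)))); apply => x _.
  have hx : nbhs x ((f \o cofun h) @^-1` (ball (f (cofun h x)) (e / 2))°).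
    apply: (cfh h); apply: open_nbhs_nbhs; split; first exact: open_interior.
    exact: nbhsx_ballx.
  have [V Vx VO] := polish_regular pZ hx.
  have nh : nbhs h [set k : C | forall z, closure V z ->
      (f @^-1` (ball (f (cofun h x)) (e / 2))°) (cofun k z)].
    apply: compact_open_map_nbhs => //.
    - by apply: (subclosed_compact _ cZ) => //; exact: closed_closure.
    - by apply: open_comp; [move=> ? _; exact: cf|exact: open_interior].
  exists (V, [set k : C | forall z, closure V z ->
      (f @^-1` (ball (f (cofun h x)) (e / 2))°) (cofun k z)]); first by split.
  move=> [z k] [/= Vz kV]; rewrite (splitr e).
  have cVz : closure V z by exact: subset_closure.
  apply: (@ball_triangle _ _ (f (cofun h x))).
    by apply: ball_sym; apply: interior_subset; exact: (VO z).
  by apply: interior_subset; exact: kV.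
- apply: continuous_comp_initial => k; apply/compact_open_cvgP => [|K O cK oO kKO].
    by apply: fmap_filter; exact: nbhs_filter.
  rewrite /nbhs /= /fmap /=.
  suff : \forall k' \near k, K `<=` [set z | O (g ((k' : continuousType Z M) z))].
    by apply: filterS => k' k'K _ [z Kz <-]; exact: k'K.
  move: cK => /compact_near_coveringP/(_ _ (nbhs k)
    (fun k' z => O (g ((k' : continuousType Z M) z)))); apply => x Kx.
  have : nbhs (((k : continuousType Z M) : Z -> M) x) (g @^-1` O).
    by apply: cg; apply: open_nbhs_nbhs; split=> //; apply: kKO; exists x.
  rewrite -nbhs_ballE => -[e /= e0 eO]; have e20 : 0 < e / 2 by rewrite divr_gt0.
  exists (((k : continuousType Z M) : Z -> M) @^-1`
      ball (((k : continuousType Z M) : Z -> M) x) (e / 2), ball k (e / 2)) => /=.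
    split; last exact: nbhsx_ballx.
    by apply: (@cts_fun _ _ (k : continuousType Z M)); exact: nbhsx_ballx.
  move=> [z k'] /= [kz kk']; apply: eO; rewrite (splitr e).
  by apply: ball_triangle kz _; exact: kk'.
- by move=> h; apply: cofun_inj; apply/funext => z; exact: fK.
- by move=> k; apply/continuousEP => z; exact: gK.
Qed.

Lemma polish_compact_open_map : polish R C.
Proof.
have [sX [M cM XM]] := pX.
apply: polish_homeomorphic (compact_open_uniform XM) _.
apply: polish_uniform_maps => //.
exact: polish_homeomorphic (homeomorphic_sym XM) pX.
Qed.

Lemma cofun_eval_continuous : continuous (fun zh : Z * C => cofun zh.2 zh.1).
Proof.
move=> [z h] U /= hU.
have : nbhs z (cofun h @^-1` U°).
  by apply: cofun_continuous; exact: nbhs_interior.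
move=> /(polish_regular pZ)[V Vz VU].
exists (V, [set k : C | forall t, closure V t -> U° (cofun k t)]) => /=.
  split=> //; apply: compact_open_map_nbhs.
  - by apply: (subclosed_compact _ cZ) => //; exact: closed_closure.
  - exact: open_interior.
  - by move=> t /VU.
move=> [t k] [/= Vt kV]; apply: interior_subset; apply: kV.
exact: subset_closure.
Qed.

End compact_open_maps.

(** * Injective Borel images and uniformization *)

(** The Lusin-Souslin theorem: the image is the injective projection of the
    Borel set of the points of the graph lying over [A]. *)
Theorem injective_borel_image (R : realType) (X Y : topologicalType)
    (f : X -> Y) (A : set X) : polish R X -> polish R Y -> borel_map f ->
  borel A -> {in A &, injective f} -> borel (f @` A).
Proof.
move=> pX pY bf bA injf.
have [B cB] := polish_countable_base pY.
pose G := (fst @^-1` A) `&` [set z : X * Y | f z.1 = z.2].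
have -> : f @` A = snd @` G.
  apply/seteqP; split=> [_ [x Ax <-]|_ [[x y] [/= Ax fxy] <-]]; last by exists x.
  by exists (x, f x).
apply: (injective_continuous_image (polish_prod pX pY)) => //.
- exact: snd_continuous.
- apply: borelI; last exact: borel_graph (polish_hausdorff pY) cB bf.
  exact: (continuous_borel_map (@fst_continuous _ _)).
- move=> [x y] [x' y'] /set_mem[/= Ax <-] /set_mem[/= Ax' <-] /= fxx'.
  by congr (_, _) => //; apply: injf; rewrite ?inE.
Qed.

Section large_sections.
Context {R : realType} {W X : topologicalType} {J : W -> set (set X)}.
Hypotheses (pW : polish R W) (pX : polish R X).
Hypothesis J0 : forall w, J w set0.
Hypothesis JU : forall w (F : (set X)^nat),
  (forall n, J w (F n)) -> J w (\bigcup_n F n).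
Hypothesis borelJ : forall B : set (W * X),
  borel B -> borel [set w | J w (xsection B w)].

(** Over a point [w] one follows, in a complete cover of [A], the leftmost branch
    all of whose nodes have a large section at [w]; such a branch exists because
    the small sets are closed under countable unions, and its limit lies in the
    section of [A]. *)
Theorem large_section_uniformization (A : set (W * X)) : borel A ->
  (forall w, xsection A w = set0 \/ ~ J w (xsection A w)) ->
  exists phi : set (W * X), [/\ borel phi, phi `<=` A &
    forall w, xsection A w !=set0 -> exists x, xsection phi w = [set x]].
Proof.
move=> bA largeA.
have pWX := polish_prod pW pX; have hWX := polish_hausdorff pWX.
have [U cU] := borel_has_complete_cover pWX bA; have [bU AU _] := cU.
pose large s := [set w | ~ J w (xsection (node A U s) w)].
have blarge s : borel (large s) by apply: borelC; apply: borelJ; exact: borel_node.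
(* [left s] holds at [w] when [s] is reached from the root by passing, at every
   step, to the least child that is large at [w]. *)
pose left s := [set w | forall n, (n <= size s)%N -> large (take n s) w /\
  forall i, (n < size s)%N -> (i < nth 0%N s n)%N -> ~ large (rcons (take n s) i) w].
have bleft s : borel (left s).
  have -> : left s = \bigcap_(n in [set n | (n <= size s)%N]) (large (take n s) `&`
      \bigcap_(i in [set i | (n < size s)%N /\ (i < nth 0%N s n)%N])
        ~` large (rcons (take n s) i)).
    apply/seteqP; split=> w lw n ns.
      by split; [have [] := lw n ns|move=> i [/= ? ?]; have [_] := lw n ns; exact].
    by have [? lc] := lw n ns; split=> // i ? ?; apply: lc.
  apply: borel_bigcap => // n _; apply: borelI => //; apply: borel_bigcap => // i _.
  exact: borelC.
have left_large s w : left s w -> large s w.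
  by move=> /(_ (size s) (leqnn _))[+ _]; rewrite take_size.
have left_next s w : left s w -> exists i, left (rcons s i) w.
  move=> lw.
  have [i li] : exists i, large (rcons s i) w.
    apply: contrapT => /forallNP nl; apply: (left_large _ _ lw).
    have -> : xsection (node A U s) w = \bigcup_i xsection (node A U (rcons s i)) w.
      apply/seteqP; split=> x.
        rewrite /xsection /= inE => /(node_rcons_cover (AU _))[i ?].
        by exists i => //; rewrite /= inE.
      by move=> [i _]; rewrite /xsection /= !inE; exact: node_rcons_sub.
    by apply: JU => i; have /contrapT := nl i.
  have exl : exists i, `[< large (rcons s i) w >] by exists i; exact/asboolP.
  case: (ex_minnP exl) => k /asboolP lk kmin; exists k => n.
  rewrite size_rcons leq_eqVlt => /predU1P[->|].
    rewrite take_oversize ?size_rcons//; split=> // j.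
    by rewrite ltnn.
  rewrite ltnS => ns; have [ln lc] := lw n ns.
  rewrite -cats1 takel_cat//; split=> // j _.
  move: ns; rewrite leq_eqVlt => /predU1P[nE|ns].
    rewrite nth_cat nE ltnn subnn /= take_size => jk lj.
    have /kmin : `[< large (rcons s j) w >] by exact/asboolP.
    by rewrite leqNgt jk.
  by rewrite nth_cat ns; exact: lc.
have left_inj s t w : left s w -> left t w -> size s = size t -> s = t.
  move=> ls lt st; apply: (@eq_from_nth _ 0%N) => // n.
  elim/ltn_ind: n => n IH ns.
  have nt : (n < size t)%N by rewrite -st.
  have ts : take n s = take n t.
    apply: (@eq_from_nth _ 0%N) => [|m]; rewrite !size_take ns ?nt// => mn.
    by rewrite !nth_take//; apply: IH => //; exact: ltn_trans ns.
  have large_nth (r : seq nat) : left r w -> (n < size r)%N ->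
      large (rcons (take n r) (nth 0%N r n)) w.
    by move=> lr nr; rewrite -take_nth//; have [] := lr n.+1 nr.
  have [_ lcs] := ls n (ltnW ns); have [_ lct] := lt n (ltnW nt).
  case: (ltngtP (nth 0%N s n) (nth 0%N t n)) => // [lt_st|lt_ts].
    by case: (lct _ nt lt_st); rewrite -ts; exact: large_nth.
  by case: (lcs _ ns lt_ts); rewrite ts; exact: large_nth.
have left_branch w : xsection A w !=set0 ->
    exists a : nat -> nat, forall n, left (mkseq a n) w.
  move=> [x Ax]; apply: (tree_branch (P := fun s => left s w)) => [n /=|s]; last exact: left_next.
  rewrite leqn0 => /eqP ->; split=> //.
  by rewrite /large /= node_nil; have [A0|//] := largeA w; rewrite A0 in Ax.
(* Over [w] these are the points adhering to all nodes of the leftmost branch. *)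
pose phi := \bigcap_n \bigcup_(s in [set s | size s = n])
  ((fst @^-1` left s) `&` closure (node A U s)).
have limP w a : (forall n, left (mkseq a n) w) ->
    exists2 x, A (w, x) & xsection phi w = [set x].
  move=> la.
  have na n : exists x, node A U (mkseq a n) (w, x).
    apply: contrapT => /forallNP n0; apply: (left_large _ _ (la n)).
    rewrite (_ : xsection _ _ = set0)// -subset0 => x.
    by rewrite /xsection /= inE; exact: n0.
  have [n|[w' x] Ap pA] := complete_cover_branch (a := a) cU.
    by have [x nx] := na n; exists (w, x).
  have ww' : w = w'.
    apply: (polish_hausdorff pW) => P Q Pw Qw'.
    have [|n nQ] := pA (fst @^-1` Q); first exact: fst_continuous.
    have [y ny] := na n; exists w; split; first exact: nbhs_singleton.
    exact: (nQ _ ny).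
  rewrite -ww' {w' ww'} in Ap pA; exists x => //.
  apply/seteqP; split=> y; rewrite /xsection /= inE.
    move=> phiy; suff [->] : (w, y) = (w, x) by [].
    apply: (branch_adherent (pi := id) hWX _ pA) => [|n]; first exact: cvg_id.
    have [s /= sn [ls cs]] := phiy n I; rewrite image_id.
    by rewrite -(left_inj _ _ _ ls (la n)) ?size_mkseq.
  move=> -> n _; exists (mkseq a n); first by rewrite /= size_mkseq.
  split; first exact: la.
  move=> V /pA[m mV]; have [z nz] := na (maxn m n).
  exists (w, z); split; first by apply: node_mkseq_sub nz; exact: leq_maxr.
  by apply: mV; apply: node_mkseq_sub nz; exact: leq_maxl.
exists phi; split.
- apply: borel_bigcap => // n _; apply: borel_bigcup => [|s _]; first exact: countableP.
  apply: borelI; last by apply: borel_closed; exact: closed_closure.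
  exact: (continuous_borel_map (@fst_continuous _ _)).
- move=> [w y] phiy.
  have [|a la] := left_branch w.
    have [s /= sn [ls _]] := phiy 0%N I.
    apply/set0P/eqP => A0; apply: (left_large _ _ ls).
    by rewrite (size0nil sn) node_nil A0.
  have [x Ax phix] := limP w a la.
  have : xsection phi w y by rewrite /xsection /= inE.
  by rewrite phix => ->.
- by move=> w /left_branch[a /limP[x _ ?]]; exists x.
Qed.

End large_sections.

(** * Multiplicative Borel classes *)

Section multiplicative_classes.
Context {d : Order.disp_t} {W : orderType d}.
Implicit Types a b c : W.

Lemma ord_eq1_ge1 a : ord_eq1 a -> ord_ge1 a.
Proof. by move=> [b ab]; exists b; have : [set b] b by []; rewrite -ab. Qed.

Lemma ord_eq1_lt a b : ord_eq1 a -> (b < a)%O -> ~ ord_ge1 b.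
Proof.
move=> [c ac] ba [e eb].
have bc : b = c by have : [set c | (c < a)%O] b by []; rewrite ac.
have ec : e = c.
  have : [set c | (c < a)%O] e by exact: (lt_trans eb ba).
  by rewrite ac.
by move: eb; rewrite bc ec ltxx.
Qed.

Lemma ord_ge1_cases (W_wf : well_founded (fun a b : W => (a < b)%O)) a :
  ord_ge1 a -> ord_eq1 a \/ exists2 c, (c < a)%O & ord_eq1 c.
Proof.
elim/(well_founded_ind W_wf): a => a IH [b ba].
have [[c ca c1]|noc] := pselect (exists2 c, (c < a)%O & ord_ge1 c).
  have [?|[e ec e1]] := IH c ca c1; right; first by exists c.
  by exists e => //; exact: lt_trans ca.
left; exists b; apply/seteqP; split=> [e /= ea|e ->//].
apply/eqP; case: ltgtP => // eb; case: noc; last by exists e => //; exists b.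
by exists b => //; exists e.
Qed.

Section space.
Context {X : topologicalType}.
Implicit Types A B : set X.

Lemma multiplicative_class_ge1 a A : multiplicative_class a A -> ord_ge1 a.
Proof.
by move=> [e B /ord_eq1_ge1//|e b B _ /(_ 0%N) ltb _]; exists (b 0%N).
Qed.

Lemma multiplicative_class_inv a A : multiplicative_class a A ->
  (ord_eq1 a /\ closed A) \/ ~ ord_eq1 a /\
  exists (b : nat -> W) (F : (set X)^nat), [/\ forall n, ord_ge1 (b n),
    forall n, (b n < a)%O, forall n, multiplicative_class (b n) (~` F n) &
    A = \bigcap_n F n].
Proof.
move=> [e B e1 cB|e b B b1 be mB]; [by left|right; split; last by exists b, B].
by move=> /ord_eq1_lt/(_ (be 0%N)); apply.
Qed.

Lemma multiplicative_class_le a b A : (a <= b)%O ->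
  multiplicative_class a A -> ~ ord_eq1 a -> multiplicative_class b A.
Proof.
move=> ab /multiplicative_class_inv[[]//|[_ [c [F [c1 ca mF ->]]]]] _.
by apply: (multiplicative_bigcap c1) => // n; exact: lt_le_trans ab.
Qed.

End space.

Lemma multiplicative_class_preimage (X Y : topologicalType) (f : X -> Y) a
    (A : set Y) : continuous f ->
  multiplicative_class a A -> multiplicative_class a (f @^-1` A).
Proof.
move=> cf; elim=> [e B e1 cB|e b B b1 be _ mB].
  by apply: multiplicative_closed => //; apply: preimage_closed => // x _; exact: cf.
by rewrite preimage_bigcap; apply: (multiplicative_bigcap b1).
Qed.

Section polish_space.
Context {R : realType} {X : topologicalType}.
Hypothesis pX : polish R X.
Hypothesis W_wf : well_founded (fun a b : W => (a < b)%O).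
Implicit Types A B : set X.

Lemma multiplicative_class_of_closed a A : ord_ge1 a -> closed A ->
  multiplicative_class a A.
Proof.
move=> /(ord_ge1_cases W_wf)[a1|[c ca c1]] cA; first exact: multiplicative_closed.
have [V oV ->] := polish_closed_Gdelta pX cA.
apply: (multiplicative_bigcap (b := fun=> c)) => // n; first exact: ord_eq1_ge1.
by apply: multiplicative_closed => //; exact: open_closedC.
Qed.

Lemma multiplicative_class_mono a b A : (a <= b)%O ->
  multiplicative_class a A -> multiplicative_class b A.
Proof.
move=> ab mA; have [c ca] := multiplicative_class_ge1 mA.
have [[a1 cA]|[na1 _]] := multiplicative_class_inv mA.
  by apply: multiplicative_class_of_closed => //; exists c; exact: lt_le_trans ab.
exact: (multiplicative_class_le ab mA).
Qed.

Lemma multiplicative_classI a A B : multiplicative_class a A ->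
  multiplicative_class a B -> multiplicative_class a (A `&` B).
Proof.
move=> /multiplicative_class_inv[[a1 cA]|[na1 [b [F [b1 ba mF ->]]]]].
  move=> /multiplicative_class_inv[[_ cB]|[//]].
  by apply: multiplicative_closed => //; exact: closedI.
move=> /multiplicative_class_inv[[//]|[_ [c [G [c1 ca mG ->]]]]].
have -> : \bigcap_n F n `&` \bigcap_n G n =
    \bigcap_n (if odd n then F n./2 else G n./2).
  apply/seteqP; split=> [x [Fx Gx] n _|x FGx]; first by case: ifP => _; [exact: Fx|exact: Gx].
  split=> n _; last by have := FGx n.*2 I; rewrite odd_double doubleK.
  by have := FGx n.*2.+1 I; rewrite /= odd_double /= uphalf_double.
by apply: (multiplicative_bigcap
  (b := fun n => if odd n then b n./2 else c n./2)) => n; case: ifP.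
Qed.

Lemma multiplicative_classU a A B : multiplicative_class a A ->
  multiplicative_class a B -> multiplicative_class a (A `|` B).
Proof.
move=> /multiplicative_class_inv[[a1 cA]|[na1 [b [F [b1 ba mF ->]]]]].
  move=> /multiplicative_class_inv[[_ cB]|[//]].
  by apply: multiplicative_closed => //; exact: closedU.
move=> /multiplicative_class_inv[[//]|[_ [c [G [c1 ca mG ->]]]]].
pose p k : nat * nat := odflt (0, 0)%N (unpickle k).
have -> : \bigcap_n F n `|` \bigcap_n G n =
    \bigcap_k (F (p k).1 `|` G (p k).2).
  apply/seteqP; split=> [x [Fx|Gx] k _|x FGx]; [by left; exact: Fx|by right; exact: Gx|].
  apply: contrapT => /not_orP[/existsNP[m nFm] /existsNP[n nGn]].
  have := FGx (pickle (m, n)) I; rewrite /p pickleK /=.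
  by case=> ?; [apply: nFm|apply: nGn].
apply: (multiplicative_bigcap
  (b := fun k => Order.max (b (p k).1) (c (p k).2))) => k.
- by rewrite /Order.max; case: ifP.
- by rewrite gt_max ba ca.
rewrite setCU; apply: multiplicative_classI.
  by apply: multiplicative_class_mono (mF _); rewrite le_max lexx.
by apply: multiplicative_class_mono (mG _); rewrite le_max lexx orbT.
Qed.

End polish_space.

Lemma pointclass_Pi0 (R : realType) a :
  well_founded (fun a b : W => (a < b)%O) -> ord_ge1 a ->
  is_pointclass R (Pi0 a).
Proof.
move=> W_wf a1; split=> [X Y f _ _ cf B|X pX].
  exact: multiplicative_class_preimage.
split.
- by apply: (multiplicative_class_of_closed pX W_wf a1); exact: closed0.
- by apply: (multiplicative_class_of_closed pX W_wf a1); exact: closedT.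
- by move=> A B; exact: multiplicative_classI.
- by move=> A B; exact: (multiplicative_classU pX W_wf).
Qed.

End multiplicative_classes.

(** * Universal sets *)

Lemma cantor_cylinderP (x : cantor_space) (U : set cantor_space) :
  nbhs x U <-> exists n, forall y : cantor_space,
    (forall i, (i < n)%N -> y i = x i) -> U y.
Proof.
split=> [xU|[n nU]].
  pose F := filter_from setT (fun n =>
    [set y : cantor_space | forall i, (i < n)%N -> y i = x i]).
  have FF : Filter F.
    apply: filter_from_filter; first by exists 0%N.
    move=> m n _ _; exists (maxn m n) => // y yx.
    by split=> i im; apply: yx; rewrite leq_max im ?orbT.
  have Fx : F --> x.
    apply/cvg_sup => i V [_ [[B oB <-] Bx BV]]; exists i.+1 => // y yx.
    by apply: BV; rewrite /= yx.
  by have [n _ nU] := Fx _ xU; exists n.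
suff : nbhs x [set y : cantor_space | forall i, (i < n)%N -> y i = x i].
  exact: filterS.
elim: n {nU} => [|n IH]; first by apply: filterS filterT.
have xn : nbhs x [set y : cantor_space | y n = x n].
  have : nbhs (x : prod_topology (fun _ : nat => bool)) (proj n @^-1` [set x n]).
    apply: proj_continuous; apply: open_nbhs_nbhs; split=> //.
    exact: discrete_open.
  exact: filterS.
apply: filterS (filterI IH xn) => y [yx yxn] i.
by rewrite ltnS leq_eqVlt => /predU1P[->//|]; exact: yx.
Qed.

Lemma cantor_reindex_continuous (r : nat -> nat) :
  continuous (fun x : cantor_space => (fun n => x (r n)) : cantor_space).
Proof.
move=> x U /cantor_cylinderP[n nU]; apply/cantor_cylinderP.
exists (\max_(i < n) r i).+1 => y yx; apply: nU => i i_n; apply: yx.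
by rewrite ltnS; exact: (leq_bigmax (Ordinal i_n)).
Qed.

Lemma cantor_coord_borel n : borel [set x : cantor_space | x n].
Proof.
apply: borel_open; rewrite openE => x /= xn; apply/cantor_cylinderP.
by exists n.+1 => y yx; rewrite /= yx.
Qed.

(** A code for a set of the additive class of [a] lists, for every [b < a],
    countably many codes of sets of the additive class of [b]: the coded set is
    the union of the complements of the sets that these describe. *)
Theorem universal_additive (R : realType) (d : Order.disp_t) (W : orderType d)
    (P : topologicalType) (a : W) : countable [set: W] ->
  well_founded (fun a b : W => (a < b)%O) -> polish R P -> ord_ge1 a ->
  exists2 U : set (cantor_space * P), borel U &
    forall A : set P, multiplicative_class a (~` A) ->
      exists x : cantor_space, xsection U x = A.
Proof.
move=> cW W_wf pP; elim/(well_founded_ind W_wf): a => a IH a1.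
have [B [oB nB]] := polish_countable_base pP.
have [eq1|neq1] := pselect (ord_eq1 a).
  exists (\bigcup_n ((fst @^-1` [set x : cantor_space | x n]) `&` (snd @^-1` B n))).
    apply: borel_bigcup_nat => n; apply: borelI.
      by apply: (continuous_borel_map (@fst_continuous _ _)); exact: cantor_coord_borel.
    apply: (continuous_borel_map (@snd_continuous _ _)); exact: borel_open.
  move=> A /multiplicative_class_inv[[_ cA]|[//]].
  have oA : open A by rewrite -(setCK A); exact: closed_openC.
  exists (fun n => `[< B n `<=` A >]); apply/seteqP; split=> p; rewrite /xsection /= inE.
    by move=> [n _ [/= /asboolP BA Bp]]; exact: BA.
  move=> Ap; have [n Bp BA] := nB p A (open_nbhs_nbhs (conj oA Ap)).
  by exists n => //; split=> //=; exact/asboolP.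
have [g ginj] : exists g : W -> nat, injective g.
  move: cW => /countable_injP[g gi]; exists g => b c bc.
  by apply: gi; rewrite ?inE.
have /choice[U UP] : forall b, exists U : set (cantor_space * P),
    (b < a)%O -> ord_ge1 b -> borel U /\
    forall A : set P, multiplicative_class b (~` A) ->
      exists x : cantor_space, xsection U x = A.
  move=> b; have [ba|?] := pselect (b < a)%O; last by exists set0.
  have [b1|?] := pselect (ord_ge1 b); last by exists set0.
  by have [U bU UP] := IH b ba b1; exists U.
pose part (k : W * nat) (x : cantor_space) : cantor_space :=
  fun n => x (pickle (g k.1, k.2, n)).
pose D := [set k : W * nat | (k.1 < a)%O /\ ord_ge1 k.1].
have cD : countable D.
  have : countable ([set: W] `*` [set: nat]) by apply: countableX => //; exact: countableP.
  by apply: sub_countable; exact: subset_card_le.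
exists (\bigcup_(k in D) [set z | ~ U k.1 (part k z.1, z.2)]).
  apply: borel_bigcup => // k [ka k1]; have [bU _] := UP _ ka k1.
  apply: (@borelC _ ((fun z => (part k z.1, z.2)) @^-1` U k.1)).
  apply: continuous_borel_map bU; apply: pair_continuous; last exact: snd_continuous.
  move=> z; apply: continuous_comp; first exact: fst_continuous.
  exact: cantor_reindex_continuous.
move=> A /multiplicative_class_inv[[//]|[_ [b [F [b1 ba mF AF]]]]].
have FcE n : exists x, xsection (U (b n)) x = F n.
  by have [_] := UP _ (ba n) (b1 n); apply; exact: mF.
have {FcE}/choice[z zE] := FcE.
have fullE k : exists x, D k -> xsection (U k.1) x = setT.
  have [Dk|?] := pselect (D k); last by exists point.
  have [_] := UP _ Dk.1 Dk.2.
  move=> /(_ setT)[|x xE]; last by exists x.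
  rewrite setCT; apply: (multiplicative_class_of_closed pP W_wf Dk.2).
  exact: closed0.
have {fullE}/choice[full fullE] := fullE.
(* The sets [F n] are coded at the places [(b n, n)]; codes of the whole space fill
   the other places, which then contribute nothing to the union. *)
pose code k := if `[< k.1 = b k.2 >] then z k.2 else full k.
pose x : cantor_space := fun m => `[< exists k n, m = pickle (g k.1, k.2, n) /\ code k n >].
have partE k : part k x = code k.
  apply/funext => n; rewrite /part /x.
  apply/asboolP/idP => [[k' [n' [kE cE]]]|cE]; last by exists k, n.
  have [/ginj kE1 kE2 kE3] : (g k.1, k.2, n) = (g k'.1, k'.2, n').
    exact: (pcan_inj pickleK).
  by rewrite (surjective_pairing k) kE1 kE2 kE3 -surjective_pairing.
exists x; rewrite -(setCK A) AF setC_bigcap.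
apply/seteqP; split=> p; rewrite /xsection /= inE.
  move=> [k Dk]; rewrite /= partE /code; case: ifPn => [/asboolP kE|_] nU.
    exists k.2 => // Fp; apply: nU; rewrite kE.
    have : xsection (U (b k.2)) (z k.2) p by rewrite zE.
    by rewrite /xsection /= inE.
  have : xsection (U k.1) (full k) p by rewrite fullE.
  by rewrite /xsection /= inE.
move=> [n _ nFp]; exists (b n, n); first by split; [exact: ba|exact: b1].
rewrite /= partE /code /= asboolT// => Up; apply: nFp.
by rewrite -zE /xsection /= inE.
Qed.

(** * Polish groups that are not locally compact *)

Lemma dependent_choice_step (T : Type) (P : nat -> T -> Prop)
    (Q : nat -> T -> T -> Prop) : (exists x, P 0%N x) ->
  (forall n x, P n x -> exists2 y, P n.+1 y & Q n x y) ->
  exists f : nat -> T, forall n, P n (f n) /\ Q n (f n) (f n.+1).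
Proof.
move=> [x0 Px0] PS.
have /choice[next nextP] : forall nx : nat * T, exists y,
    P nx.1 nx.2 -> P nx.1.+1 y /\ Q nx.1 nx.2 y.
  move=> [n x]; have [/PS[y ? ?]|?] := pselect (P n x); first by exists y.
  by exists x0.
pose fix f n := if n is m.+1 then next (m, f m) else x0.
have Pf n : P n (f n) by elim: n => //= n /(nextP (n, f n))[].
by exists f => n; split=> //; have [] := nextP (n, f n) (Pf n).
Qed.

Section group_neighborhoods.
Context {X : topologicalZmodType}.
Implicit Types (U V : set X) (x y : X).

Lemma addl_continuous x : continuous (fun y : X => x + y).
Proof.
move=> y; apply: (@continuous_comp _ _ _ (fun y : X => (x, y)) (fun z : X * X => z.1 + z.2)).
  by apply: cvg_pair; [exact: cvg_cst|exact: cvg_id].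
exact: add_continuous.
Qed.

Lemma nbhs_add0 x U : nbhs x U -> nbhs 0 [set v | U (x + v)].
Proof. by move=> xU; have /addl_continuous : nbhs (x + 0) U by rewrite addr0. Qed.

Lemma open_subr x U : open U -> open [set y | U (y - x)].
Proof.
move=> oU; have -> : [set y | U (y - x)] = (fun y => - x + y) @^-1` U.
  by apply/seteqP; split=> y /=; rewrite addrC.
by apply: open_comp => // y _; exact: addl_continuous.
Qed.

Lemma nbhs_sub0 x U : nbhs 0 U -> nbhs x [set y | U (y - x)].
Proof.
move=> U0; have : nbhs x ((fun y => - x + y) @^-1` U).
  by apply: addl_continuous; rewrite addNr.
by apply: filterS => y /=; rewrite addrC.
Qed.

Definition symmetric V := forall x, V x -> V (- x).

Lemma nbhs0_symmetric U : nbhs (0 : X) U ->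
  exists V, [/\ open V, V 0, symmetric V & V `<=` U].
Proof.
move=> U0; exists (U° `&` (-%R @^-1` U°)); split.
- apply: openI; first exact: open_interior.
  by apply: open_comp; [move=> x _; exact: opp_continuous|exact: open_interior].
- by split; rewrite /= ?oppr0; exact: nbhs_singleton (nbhs_interior U0).
- by move=> x [Ux Unx]; split; rewrite /= ?opprK.
- by move=> x [+ _]; exact: interior_subset.
Qed.

Definition nsum V (n : nat) : set X := [set x | exists s : seq X,
  [/\ size s = n, forall y, y \in s -> V y & x = \sum_(y <- s) y]].

Lemma nsum1 V x : V x -> nsum V 1 x.
Proof.
move=> Vx; exists [:: x]; split=> //; last by rewrite big_seq1.
by move=> y; rewrite mem_seq1 => /eqP ->.
Qed.

Lemma nsum0 V n : V 0 -> nsum V n 0.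
Proof.
move=> V0; exists (nseq n 0); split; first by rewrite size_nseq.
  by move=> y /nseqP[->].
by rewrite big_nseq; elim: n => //= n <-; rewrite addr0.
Qed.

Lemma nsumD V m n x y : nsum V m x -> nsum V n y -> nsum V (m + n) (x + y).
Proof.
move=> [s [sm Vs ->]] [t [tn Vt ->]]; exists (s ++ t).
split; rewrite ?size_cat ?sm ?tn ?big_cat// => z.
by rewrite mem_cat => /orP[/Vs|/Vt].
Qed.

Lemma nsumN V n x : symmetric V -> nsum V n x -> nsum V n (- x).
Proof.
move=> symV [s [sn Vs ->]]; exists (map -%R s).
split; rewrite ?size_map// ?big_map ?sumrN// => y /mapP[z /Vs Vz ->].
exact: symV.
Qed.

Lemma nsum_le V m n : V 0 -> (m <= n)%N -> nsum V m `<=` nsum V n.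
Proof.
move=> V0 mn x mx; rewrite -(subnKC mn) -(addr0 x).
by apply: nsumD => //; exact: nsum0.
Qed.

Lemma nbhs0_nsum n U : nbhs (0 : X) U -> exists2 V, nbhs 0 V & nsum V n `<=` U.
Proof.
elim: n U => [|n IH] U U0.
  exists setT; first exact: filterT.
  by move=> _ [s [/size0nil -> _ ->]]; rewrite big_nil; exact: nbhs_singleton.
have [|[P Q] /= [P0 Q0] PQU] := add_continuous ((0, 0) : X * X) (U).
  by rewrite /= addr0.
have [V V0 VQ] := IH Q Q0; exists (P `&` V); first exact: filterI.
move=> _ [[|y s] [//= [sn] ys ->]]; rewrite big_cons.
apply: (PQU (y, _)); split=> /=; first by case: (ys y (mem_head _ _)).
by apply: VQ; exists s; split=> // z zs; case: (ys z) => //; rewrite in_cons zs orbT.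
Qed.

Lemma nbhs0_small n U : nbhs (0 : X) U ->
  exists V, [/\ open V, V 0, symmetric V & nsum V n `<=` U].
Proof.
move=> /(nbhs0_nsum n)[V0 V00 VU].
have [V [oV V1 sV VV0]] := nbhs0_symmetric V00; exists V; split=> // _ [s [sn Vs ->]].
by apply: VU; exists s; split=> // y /Vs /VV0.
Qed.

End group_neighborhoods.

Section polish_group.
Context {R : realType} {X : topologicalZmodType}.
Hypothesis pX : polish R X.

Lemma nbhs0_countable_base : exists N : nat -> set X,
  (forall n, nbhs 0 (N n)) /\ forall U, nbhs (0 : X) U -> exists n, N n `<=` U.
Proof.
have [B [oB xB]] := polish_countable_base pX.
exists (fun n => if `[< B n 0 >] then B n else setT); split=> [n|U /xB[n Bn BU]].
  case: ifPn => [/asboolP Bn|_]; last exact: filterT.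
  exact: open_nbhs_nbhs.
by exists n; rewrite asboolT.
Qed.

(** A Cauchy sequence [x] converges.  Completeness of some metric, which is not
    assumed to be invariant, is exploited by writing terms [x n] as sums [a + b]
    so that both [a] and [b] stay in shrinking members of the complete covers:
    when [a] is fixed and its neighbourhood chosen, all late differences
    [x m - x n] are so small that adding them to [a] does not leave it, and the
    roles of [a] and [b] can be exchanged. *)
Lemma polish_group_complete (x : nat -> X) :
  (forall V, nbhs (0 : X) V -> exists n, forall m, (n <= m)%N -> V (x m - x n)) ->
  exists l, forall V, nbhs (0 : X) V -> exists n, forall m, (n <= m)%N -> V (x m - l).
Proof.
move=> cx; have [B [oB xB] cB] := polish_base_covers pX.
have cx2 V N : nbhs (0 : X) V ->
    exists2 n, (N <= n)%N & forall m, (n <= m)%N -> V (x m - x n).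
  move=> /(nbhs0_small 2)[V' [oV' V'0 sV' V'V]].
  have [n nV'] := cx V' (open_nbhs_nbhs (conj oV' V'0)).
  exists (maxn n N) => [|m]; first exact: leq_maxr.
  rewrite geq_max => /andP[nm _]; apply: V'V.
  have -> : x m - x (maxn n N) = (x m - x n) + - (x (maxn n N) - x n).
    by rewrite opprB addrA subrK.
  apply: (@nsumD _ _ 1 1); apply: nsum1; first exact: nV'.
  by apply/sV'/nV'; exact: leq_maxl.
(* The current summand [a] lies in [A], and any late complement [x m - a] in [C]. *)
pose inv a (A C : set X) n := [/\ open A, A a, open C &
  forall m, (n <= m)%N -> C (x m - a)].
have exchange k a A C n : inv a A C n -> exists b A' n', [/\ inv b C A' n',
    a + b = x n', (k <= n')%N, A' a &
    A' `<=` A /\ exists i j, (k <= i)%N /\ A' `<=` B i j].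
  move=> [oA Aa oC Cx].
  have [i [j [ki Ba BA]]] := xB a A k (open_nbhs_nbhs (conj oA Aa)).
  have /nbhs_add0/(cx2 _ (maxn k n))[n' kn' n'x] : nbhs a (B i j).
    exact: open_nbhs_nbhs.
  move: kn'; rewrite geq_max => /andP[kn' nn'].
  exists (x n' - a), (B i j), n'; split=> //; last by split=> //; exists i, j; split.
    split=> //; first exact: Cx.
    by move=> m n'm; rewrite opprB addrCA; exact: n'x.
  by rewrite addrC subrK.
have [||s sP] := @dependent_choice_step (X * set X * set X * nat)%type
  (fun k s => inv s.1.1.1 s.1.1.2 s.1.2 s.2)
  (fun k s t => t.1.1.2 `<=` s.1.1.2 /\ t.1.2 `<=` s.1.2 /\
    (exists i j, (k <= i)%N /\ t.1.1.2 `<=` B i j) /\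
    (exists i j, (k <= i)%N /\ t.1.2 `<=` B i j) /\ (k <= t.2)%N /\
    exists a b, [/\ t.1.1.2 a, t.1.2 b & a + b = x t.2]).
- exists (0, setT, setT, 0%N); split=> //; exact: openT.
- move=> k [[[a A] C] n] /= /(exchange k)[b [A' [n' [ib ab kn' A'a [A'A Bi]]]]].
  have [_ Cb _ _] := ib.
  have [a' [C' [n'' [ia' ba' kn'' C'b [C'C Bj]]]]] := exchange k _ _ _ _ ib.
  exists (a', A', C', n'') => //=; do 5 split=> //.
  exists a', b; split=> //; last by rewrite addrC.
  by case: ia'.
pose A k := (s k).1.1.2; pose C k := (s k).1.2.
have shrink (D : nat -> set X) : (forall k, D k.+1 `<=` D k) -> (forall k, D k !=set0) ->
    (forall k, exists i j, (k <= i)%N /\ D k.+1 `<=` B i j) ->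
    exists p : X, forall V, nbhs p V -> exists k, forall m, (k <= m)%N -> D m `<=` V.
  move=> Dk D0 DB.
  have Dmono m n : (m <= n)%N -> D n `<=` D m.
    move=> /subnKC <-; elim: (n - m)%N => [|j IH]; first by rewrite addn0.
    by rewrite addnS => y /Dk /IH.
  pose F := filter_from setT D.
  have FF : Filter F.
    apply: filter_from_filter; first by exists 0%N.
    move=> m n _ _; exists (maxn m n) => // y Dy.
    by split; apply: Dmono Dy; rewrite ?leq_maxl ?leq_maxr.
  have [n0|p Fp] := cB F (filter_from_proper FF (fun k _ => D0 k)).
    by have [i [j [n0i Dij]]] := DB n0; exists i, j; split=> //; exists n0.+1.
  by exists p => V /Fp[k _ DV]; exists k => m /Dmono Dm y /Dm /DV.
have dec k := (sP k).2.
have [||k|p pA] := shrink A.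
- by move=> k; case: (dec k).
- by move=> k; have [[_ Aa _ _] _] := sP k; exists (s k).1.1.1.
- by case: (dec k) => _ [_ [? _]].
have [||k|q qC] := shrink C.
- by move=> k; case: (dec k) => _ [].
- by move=> k; have [[_ _ _ Cx] _] := sP k; exists (x (s k).2 - (s k).1.1.1); exact: Cx.
- by case: (dec k) => _ [_ [_ [? _]]].
exists (p + q) => V /(nbhs0_small 4)[V' [oV' V'0 sV' V'V]].
have nV' := open_nbhs_nbhs (conj oV' V'0).
have [n nV] := cx V' nV'; exists n => m nm.
have [k1 k1A] := pA _ (nbhs_sub0 p nV'); have [k2 k2C] := qC _ (nbhs_sub0 q nV').
pose k := maxn n (maxn k1 k2).
have [_ [_ [_ [_ [kk [a [b [Aa Cb ab]]]]]]]] := dec k.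
have kS i : (i <= k)%N -> (i <= k.+1)%N by move=> ?; exact: leqW.
have ap : V' (a - p) by apply: (k1A k.+1) => //; apply: kS; rewrite /k leq_max leq_maxl orbT.
have bq : V' (b - q) by apply: (k2C k.+1) => //; apply: kS; rewrite /k leq_max leq_maxr orbT.
have nk : (n <= (s k.+1).2)%N by apply: leq_trans kk; exact: leq_maxl.
apply: V'V.
have -> : x m - (p + q) = (x m - x n) + (- (x (s k.+1).2 - x n)) + (a - p) + (b - q).
  by rewrite -ab opprB subrKA -addrA [a - p + _]addrACA -opprD addrA subrK.
by apply: (@nsumD _ _ 3 1); [apply: (@nsumD _ _ 2 1); [apply: (@nsumD _ _ 1 1)|]|];
  apply: nsum1 => //; [exact: nV|apply/sV'/nV].
Qed.

(** If finitely many translates of every neighbourhood of [0] covered some fixed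
    neighbourhood, a smaller closed one would be totally bounded and complete,
    hence compact, and its translates would be compact neighbourhoods. *)
Lemma not_locally_compact_net : ~ locally_compact [set: X] ->
  forall V, nbhs (0 : X) V -> exists2 W, nbhs (0 : X) W &
    forall l : seq X, exists2 v, V v & forall q, q \in l -> ~ W (v - q).
Proof.
move=> nlc V V0; apply: contrapT => nW; apply: nlc.
have cover W : nbhs (0 : X) W ->
    exists l : seq X, forall v, V v -> exists2 q, q \in l & W (v - q).
  move=> W0; apply: contrapT => /forallNP nl; apply: nW; exists W => // l.
  have /existsNP[v /not_implyP[Vv nv]] := nl l.
  by exists v => // q ql Wvq; apply: nv; exists q.
have hX := polish_hausdorff pX.
have [K K0 KV] := polish_regular pX V0.
have cK : compact (closure K).
  rewrite compact_ultra => F UF FK.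
  have FV : F V by apply: filterS FK.
  have small W : nbhs (0 : X) W -> exists q, F [set v | W (v - q)].
    move=> /cover[l Vl]; apply: contrapT => /forallNP nF.
    suff : F (~` V) by move=> FnV; have [v []] := filter_ex (filterI FV FnV).
    have : F [set v | forall q, q \in l -> ~ W (v - q)].
      elim: l {Vl} => [|q l IH]; first by apply: filterS (@filterT _ F _) => v _ q.
      have := in_ultra_setVsetC [set v | W (v - q)] UF.
      case=> [/nF//|Fq]; apply: filterS (filterI Fq IH) => v [nWq Wl] q'.
      by rewrite in_cons => /predU1P[->|/Wl].
    by apply: filterS => v nWv /Vl[q ql]; exact: nWv.
  have [N [N0 Nbase]] := nbhs0_countable_base.
  have /choice[W WP] : forall n, exists W : set X, [/\ open W, W 0, symmetric W &
      W `<=` \bigcap_(k in [set k | (k <= n)%N]) N k].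
    move=> n; apply: nbhs0_symmetric.
    elim: n => [|n IH].
      by apply: filterS (N0 0%N) => v Nv k /=; rewrite leqn0 => /eqP ->.
    apply: filterS (filterI IH (N0 n.+1)) => v [Nk Nn] k /=.
    by rewrite leq_eqVlt => /predU1P[->//|kn]; exact: Nk.
  have /choice[q Fq] : forall n, exists q, F [set v | W n (v - q)].
    move=> n; apply: small; have [oW W0 _ _] := WP n.
    exact: open_nbhs_nbhs.
  have W_small U : nbhs (0 : X) U -> exists n, forall m, (n <= m)%N -> W m `<=` U.
    move=> /Nbase[n NU]; exists n => m nm v; have [_ _ _ WN] := WP m.
    by move=> /WN/(_ n nm); exact: NU.
  have [|l ql] := polish_group_complete (x := q).
    move=> U /(nbhs0_small 2)[U' [oU' U'0 sU' U'U]].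
    have [n nU'] := W_small _ (open_nbhs_nbhs (conj oU' U'0)).
    exists n => m nm; have [v [vm vn]] := filter_ex (filterI (Fq m) (Fq n)).
    apply: U'U; rewrite -(subrKA v (q m)) -(opprB v (q m)).
    apply: (@nsumD _ _ 1 1); apply: nsum1; last exact: nU' vn.
    by apply: sU'; exact: nU' vm.
  have Fl : F --> l.
    move=> U /nbhs_add0/(nbhs0_small 2)[U' [oU' U'0 sU' U'U]].
    have nU' := open_nbhs_nbhs (conj oU' U'0).
    have [n nW'] := W_small _ nU'; have [m mq] := ql _ nU'.
    apply: filterS (Fq (maxn m n)) => v vq; rewrite -(subrK l v) addrC.
    apply: U'U; rewrite -(subrKA (q (maxn m n))).
    apply: (@nsumD _ _ 1 1); apply: nsum1; last by apply: mq; exact: leq_maxl.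
    by apply: nW' vq; exact: leq_maxr.
  exists l; split=> //; apply: closed_closure => U Ul.
  exact: filter_ex (filterI FK (Fl _ Ul)).
move=> x _; exists ((fun y => x + y) @` closure K).
  rewrite withinET; apply: filterS (nbhs_sub0 x K0) => y Ky.
  by exists (y - x); [exact: subset_closure|rewrite addrC subrK].
have cxK : compact ((fun y => x + y) @` closure K).
  by apply: continuous_compact => //; apply: continuous_subspaceT; exact: addl_continuous.
by split=> //; exact: compact_closed.
Qed.

(** The scale on which [separated_sums] works.  Eight summands are what the
    comparison of two sums needs there: three for each of the two tails and one
    for each of the two points that could compensate the difference. *)
Lemma not_locally_compact_scheme : ~ locally_compact [set: X] ->
  exists V : nat -> set X,
    [/\ forall n, [/\ open (V n), V n 0 & symmetric (V n)],
        forall n, nsum (V n.+1) 8 `<=` V n,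
        forall U, nbhs (0 : X) U -> exists n, V n `<=` U &
        forall n (l : seq X), exists2 v, V n v &
          forall q, q \in l -> ~ nsum (V n.+1) 8 (v - q)].
Proof.
move=> /not_locally_compact_net net.
have [N [N0 Nbase]] := nbhs0_countable_base.
have [||V VP] := @dependent_choice_step (set X)
  (fun _ V => [/\ open V, V 0 & symmetric V])
  (fun n V V' => [/\ nsum V' 8 `<=` V, V' `<=` N n & forall l : seq X,
     exists2 v, V v & forall q, q \in l -> ~ nsum V' 8 (v - q)]).
- by exists setT; split=> //; exact: openT.
- move=> n V [oV V0 sV]; have nV := open_nbhs_nbhs (conj oV V0).
  have [W W0 VW] := net V nV.
  have [V' [oV' V'0 sV' V'sub]] := nbhs0_small 8 (filterI (filterI nV W0) (N0 n)).
  exists V'; split=> //.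
  + by move=> x /V'sub[[]].
  + move=> x V'x; suff /V'sub[] : nsum V' 8 x by [].
    by apply: (nsum_le V'0 (ltn0Sn 7)); exact: nsum1.
  + move=> l; have [v Vv vl] := VW l; exists v => // q ql /V'sub[[_ Wvq] _].
    exact: vl ql Wvq.
exists V; split.
- by move=> n; have [] := VP n.
- by move=> n; have [_ []] := VP n.
- move=> U /Nbase[n NU]; exists n.+1; have [_ [_ VN _]] := VP n.
  exact: subset_trans NU.
- by move=> n; have [_ [_ _]] := VP n.
Qed.

(** [S a] is the sum of the series [\sum_n v n (a n)], and [L n m] is covered by
    finitely many translates of [V n.+1].  The points [v n m] of [V n] are chosen
    one after the other, outside finitely many translates of the eightfold sum of
    [V n.+1]; so, when the indices of two series first differ at [n], not even
    points of [L n (a n)] and [L n (a' n)] make up for the difference of the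
    sums. *)
Theorem separated_sums : ~ locally_compact [set: X] ->
  exists (S : (nat -> nat) -> X) (L : nat -> nat -> set X) (p0 : X),
  [/\ forall n m, open (L n m) /\ L n m p0,
      forall n m m', (m <= m')%N -> L n m `<=` L n m',
      forall n K, compact K -> exists m, K `<=` L n m,
      forall a U, nbhs (S a) U ->
        exists n, forall a', (forall i, (i < n)%N -> a' i = a i) -> U (S a') &
      forall a a' n p p', (forall i, (i < n)%N -> a i = a' i) -> a n <> a' n ->
        L n (a n) p -> L n (a' n) p' -> S a + p <> S a' + p'].
Proof.
move=> /not_locally_compact_scheme[V [VP V8 Vbase Vnet]].
have oV n : open (V n) by have [] := VP n.
have V0 n : V n 0 by have [] := VP n.
have sV n : symmetric (V n) by have [] := VP n.
have Vsum n m : (m <= 8)%N -> nsum (V n.+1) m `<=` V n.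
  by move=> m8 x /(nsum_le (V0 _) m8); exact: V8.
have [d [d1 dD]] := polish_dense_seq pX.
have /choice[q qP] : forall n, exists q, forall x, d n x -> x = q.
  move=> n; have [[x dx]|nd] := pselect (exists x, d n x).
    by exists x => y dy; exact: d1 dx.
  by exists 0 => x dx; case: nd; exists x.
pose L n m : set X := [set p | exists2 i, (i <= m)%N & V n.+1 (p - q i)].
have /choice[v vP] : forall n, exists v : nat -> X, forall m, V n (v m) /\
    forall m' i j, (m' < m)%N -> (i <= m)%N -> (j <= m')%N ->
      ~ nsum (V n.+1) 8 (v m - (v m' + (q j - q i))).
  move=> n; pose Q s y := V n y /\ forall m' i j, (m' < size s)%N ->
    (i <= size s)%N -> (j <= m')%N ->
    ~ nsum (V n.+1) 8 (y - (nth 0 s m' + (q j - q i))).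
  have [s|v vQ] := @history_choice X Q.
    have [y Vy yl] := Vnet n [seq x + (q ij.1 - q ij.2) | x <- s,
      ij <- [seq (i, j) | i <- iota 0 (size s).+1, j <- iota 0 (size s).+1]].
    exists y; split=> // m' i j m's i_s jm'; apply: yl.
    apply/allpairsP; exists (nth 0 s m', (j, i)); split; [exact: mem_nth| |by []].
    apply/allpairsP; exists (j, i); split; [| |by []]; rewrite mem_iota add0n ltnS //=.
    by rewrite (leq_trans jm')// ltnW.
  exists v => m; have [Vv vm] := vQ m; split=> // m' i j m'm im jm'.
  have := vm m' i j; rewrite size_mkseq => /(_ m'm im jm').
  by rewrite nth_mkseq.
pose sigma (a : nat -> nat) n : X := \sum_(i < n) v i (a i).
have sigmaS a n : sigma a n.+1 = sigma a n + v n (a n) by rewrite /sigma big_ord_recr.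
have tail2 a k j : nsum (V k) 2 (sigma a (k + j)%N - sigma a k).
  elim: j k => [|j IH] k; first by rewrite addn0 subrr; exact: nsum0.
  rewrite addnS -addSn -(subrKA (sigma a k.+1)) [X in _ + X](_ : _ = v k (a k)).
    apply: (@nsumD _ _ 1 1); apply: nsum1; last by have [] := vP k (a k).
    by apply: (@Vsum k 2) => //; exact: IH.
  by rewrite sigmaS addrC addKr.
have /choice[S SP] : forall a : nat -> nat, exists l, forall U, nbhs (0 : X) U ->
    exists n, forall m, (n <= m)%N -> U (sigma a m - l).
  move=> a; apply: polish_group_complete => U /Vbase[n VU]; exists n.+1 => m nm.
  by apply: VU; rewrite -(subnKC nm); apply: (@Vsum n 2) => //; exact: tail2.
have tail3 a k : nsum (V k) 3 (S a - sigma a k).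
  have [n nV] := SP a (V k) (open_nbhs_nbhs (conj (oV k) (V0 k))).
  rewrite -(subrKA (sigma a (k + n)%N)); apply: (@nsumD _ _ 1 2); last exact: tail2.
  by apply: nsum1; rewrite -opprB; apply: sV; apply: nV; exact: leq_addl.
have sigma_eq a a' n : (forall i, (i < n)%N -> a i = a' i) -> sigma a n = sigma a' n.
  by move=> aa'; apply: eq_bigr => i _; rewrite aa'.
have sep a a' n p p' : (forall i, (i < n)%N -> a i = a' i) -> (a' n < a n)%N ->
    L n (a n) p -> L n (a' n) p' -> S a + p <> S a' + p'.
  move=> aa' lt [i ia pi] [j ja pj] SE.
  have [_ /(_ (a' n) i j lt ia ja)] := vP n (a n); apply.
  have -> : v n (a n) - (v n (a' n) + (q j - q i)) =
      ((S a' - sigma a' n.+1) - (S a - sigma a n.+1)) + ((p' - q j) - (p - q i)).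
    have subBB (w x y z : X) : (w - x) - (y - z) = (w - y) - (x - z).
      by rewrite opprB [z - y]addrC addrACA opprB [z - x]addrC.
    rewrite (subBB _ _ (S a)) (subBB _ _ p) !sigmaS (sigma_eq _ _ _ aa').
    have -> : S a' - S a = p - p'.
      by apply/eqP; rewrite subr_eq addrAC eq_sym subr_eq addrC SE.
    by rewrite addrACA subrKA subrr add0r opprB [_ + v n (a n)]addrC addrKA opprD addrA.
  apply: (@nsumD _ _ 6 2); first apply: (@nsumD _ _ 3 3) => //.
    by apply: nsumN => //; exact: tail3.
  apply: (@nsumD _ _ 1 1); apply: nsum1 => //; exact: sV.
exists S, L, (q 0%N); split.
- move=> n m; split; last by exists 0%N => //; rewrite subrr.
  have -> : L n m = \bigcup_(i in [set i | (i <= m)%N]) [set p | V n.+1 (p - q i)].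
    by apply/seteqP; split=> p [i]; exists i.
  by apply: bigcup_open => i _; exact: open_subr.
- by move=> n m m' mm' p [i im Vp]; exists i => //; exact: leq_trans mm'.
- move=> n K cK.
  have nearq x : exists i, V n.+1 (x - q i).
    have [||i [y [dy Vy]]] := dD [set y | V n.+1 (y - x)].
    + by exists x; rewrite /= subrr.
    + exact: open_subr.
    by exists i; rewrite -(qP _ _ dy) -opprB; exact: sV.
  have /choice[idx idxP] := nearq.
  have [x _|s sK] := compact_finite_cover (f := fun x => [set y | V n.+1 (y - q (idx x))]) cK.
    by apply: open_nbhs_nbhs; split; [exact: open_subr|exact: idxP].
  exists (\max_(x <- s) idx x)%N => y /sK[x xs Vy]; exists (idx x) => //.
  by rewrite (big_rem x xs) /= leq_maxl.
- move=> a U /nbhs_add0/Vbase[n VU]; exists n.+1 => a' aa'.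
  rewrite -(subrK (S a) (S a')) addrC; apply: VU.
  rewrite -(subrKA (sigma a' n.+1)); apply: (@Vsum n 6) => //.
  apply: (@nsumD _ _ 3 3); first exact: tail3.
  by rewrite (sigma_eq _ _ _ aa') -opprB; apply: nsumN => //; exact: tail3.
- move=> a a' n p p' aa' /eqP; case: ltngtP => // [lt|lt] _ Lp Lp'.
    by move/esym; apply: sep lt Lp' Lp => i /aa'.
  exact: sep lt Lp Lp'.
Qed.

End polish_group.

(** * Property (H) *)

Lemma pointclass_borel (R : realType) : is_pointclass R borel.
Proof.
split=> [X Y f _ _ cf B|X _]; first exact: continuous_borel_map.
split; [exact: borel0|exact: borelT| |].
- by move=> A B; exact: borelI.
- by move=> A B; exact: borelU.
Qed.

Section sigma_ideals.
Context {T : Type} {I : set (set T)}.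
Hypothesis idI : sigma_ideal I.

Lemma sigma_ideal_sub A B : A `<=` B -> I B -> I A.
Proof. by have [[_ +] _] := idI; exact. Qed.

Lemma sigma_ideal0 : I set0.
Proof. by have [[[A IA] _] _] := idI; exact: sigma_ideal_sub IA. Qed.

Lemma sigma_ideal_compl A : ~ I setT -> I A -> ~ I (~` A).
Proof.
move=> nT IA IcA; apply: nT.
have <- : \bigcup_(n : nat) (if n == 0%N then A else ~` A) = setT.
  apply/seteqP; split=> // x _.
  by have [Ax|nAx] := pselect (A x); [exists 0%N|exists 1%N].
by have [_] := idI; apply=> -[|n].
Qed.

End sigma_ideals.

Section property.
Context {R : realType} {Z : topologicalType} {I : set (set Z)}.
Hypotheses (cZ : compact [set: Z]) (mZ : metrizable R Z) (idI : sigma_ideal I).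
Hypothesis borelI_borel : class_on_class R borel borel I.

Let pZ : polish R Z := polish_compact cZ mZ.

(** Membership of the preimages [h @^-1` B_w] in the ideal is a Borel condition on
    [w = (h, y)], because evaluation is continuous in both variables. *)
Lemma borel_preimage_ideal (X Y : topologicalType)
    (B : set (compact_open_map Z X * Y * X)) : polish R X -> polish R Y ->
  borel B -> borel [set w | I (cofun w.1 @^-1` xsection B w)].
Proof.
move=> pX pY bB; have pC := polish_compact_open_map cZ pZ pX.
pose ev (v : Z * (compact_open_map Z X * Y)) := (v.2, cofun v.2.1 v.1).
have cev : continuous ev.
  apply: pair_continuous; first exact: snd_continuous.
  apply: (comp_continuous (f := fun v : Z * (compact_open_map Z X * Y) => (v.1, v.2.1))
    (g := fun zh : Z * compact_open_map Z X => cofun zh.2 zh.1)).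
    apply: pair_continuous; first exact: fst_continuous.
    exact: comp_continuous (@snd_continuous _ _) (@fst_continuous _ _).
  exact: (cofun_eval_continuous cZ pZ).
exact: (borelI_borel (polish_prod pC pY) (continuous_borel_map cev bB)).
Qed.

Lemma ideal_uniformization (X Y : topologicalType)
    (A : set (compact_open_map Z X * Y * X)) : polish R X -> polish R Y ->
  borel A ->
  (forall w, xsection A w = set0 \/ ~ I (cofun w.1 @^-1` xsection A w)) ->
  exists phi : set (compact_open_map Z X * Y * X), [/\ borel phi, phi `<=` A &
    forall w, xsection A w !=set0 -> exists g, xsection phi w = [set g]].
Proof.
move=> pX pY bA largeA; have pC := polish_compact_open_map cZ pZ pX.
apply: (large_section_uniformization
  (J := fun w => [set B | I (cofun w.1 @^-1` B)]) (polish_prod pC pY) pX) => //.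
- by move=> w; rewrite /= preimage_set0; exact: sigma_ideal0.
- by move=> w F IF; rewrite /= preimage_bigcup; have [_] := idI; exact.
- by move=> B; exact: borel_preimage_ideal.
Qed.

Lemma property_H_borel_Pi0 (d : Order.disp_t) (W : orderType d) (a : W) :
  \bigcup_(A in I) A = [set: Z] -> ~ I [set: Z] ->
  countable [set: W] -> well_founded (fun a b : W => (a < b)%O) -> ord_ge1 a ->
  property_H R I borel (Pi0 a).
Proof.
move=> coverI nI cW W_wf a1; split=> //.
- by case: idI.
- exact: pointclass_borel.
- exact: pointclass_Pi0.
- by move=> A; exact: sigma_ideal_compl.
- move=> P pP; have [U bU UP] := universal_additive cW W_wf pP a1.
  by exists U => // A; exact: UP.
- move=> Y pY A bA; rewrite /dual /=; apply: borelC; exact: borelI_borel.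
- move=> X Y pX pY A bA largeA.
  have [[h y]|phi [bphi phiA phi1]] := ideal_uniformization pX pY bA; first exact: largeA.
  by exists phi; split=> // h y; exact: phi1.
- move=> X Y f pX pY injf bf A bA.
  by apply: (injective_borel_image pX pY bf bA) => x y _ _; exact: injf.
Qed.

End property.

(** * A Haar-1 set without Haar-small hulls *)

Section no_hull.
Context {R : realType} {Z : topologicalType} {X : topologicalZmodType}.
Hypotheses (cZ : compact [set: Z]) (pZ : polish R Z) (pX : polish R X).

Local Notation C := (compact_open_map Z X).
Let pC : polish R C := polish_compact_open_map cZ pZ pX.
Let hX : hausdorff_space X := polish_hausdorff pX.

(** The projection of a closed set along the compact space [Z] is closed. *)
Lemma closed_range_relation : closed [set hg : C * X | exists z, cofun hg.1 z = hg.2].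
Proof.
rewrite -openC openE => -[h g] /= hg; rewrite /interior.
suff : \forall kg \near (h, g), [set: Z] `<=` [set z | cofun kg.1 z <> kg.2].
  by apply: filterS => kg nkg [z]; exact: nkg.
move: cZ => /compact_near_coveringP/(_ _ (nbhs (h, g))
  (fun kg z => cofun kg.1 z <> kg.2)); apply => z _.
have hzg : cofun h z != g by apply/eqP => hzg; apply: hg; exists z.
move: hX; rewrite open_hausdorff => /(_ _ _ hzg)[[P Q] /= [Pz Qg] [oP oQ PQ]].
rewrite !inE in Pz Qg.
have /(cofun_eval_continuous cZ pZ) : nbhs (cofun (z, h).2 (z, h).1) P.
  exact: open_nbhs_nbhs.
move=> [[V N] /= [Vz Nh] VNP].
exists (V, (fst @^-1` N) `&` (snd @^-1` Q)) => /=.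
  split=> //; exists (N, Q) => //=; split=> //; exact: open_nbhs_nbhs.
move=> [t [k g']] /= [Vt [Nk Qg']] kt.
suff : (P `&` Q) g' by rewrite (eqP PQ).
by split=> //; rewrite -kt; exact: (VNP (t, k)).
Qed.

(** Each pair [(h, x)] is coded by a sequence of indices of a separated series, whose
    sum is [t (h, x)].  The index [n] also records a bound [m] for which the
    compact set [range h - range f] lies in [L n m], which is what separation
    needs; sequences of bits give the Cantor set [range f]. *)
Lemma disjoint_translates : ~ locally_compact [set: X] ->
  exists (f : cantor_space -> X) (t : C * cantor_space -> X),
  [/\ continuous f, injective f, borel_map t,
      forall h, continuous (fun x => t (h, x)) &
      forall w w' z z' y y', t w + (cofun w.1 z - f y) = t w' + (cofun w'.1 z' - f y') ->
        w = w'].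
Proof.
move=> /(separated_sums pX)[S [L [p0 [Lp0 Lmono Lcompact cS sepS]]]].
have first_diff (a a' : nat -> nat) : a <> a' ->
    exists2 n, (forall i, (i < n)%N -> a i = a' i) & a n <> a' n.
  move=> aa'; have exn : exists n, a n != a' n.
    apply: contrapT => /forallNP eqa; apply: aa'; apply/funext => n.
    by have /negP/negPn/eqP := eqa n.
  case: (ex_minnP exn) => n /eqP an nmin; exists n => // i i_n; apply/eqP.
  by apply: contraTT i_n => /nmin; rewrite -leqNgt.
pose f (y : cantor_space) := S (fun n => nat_of_bool (y n)).
have cf : continuous f.
  move=> y U /cS[n nU]; apply/cantor_cylinderP; exists n => y' yy'.
  by apply: nU => i i_n; rewrite yy'.
have injf : injective f.
  move=> y y' fyy'; apply/funext => n; apply/eqP/negPn/negP => yn.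
  have [|k ky ny] := first_diff (fun n => nat_of_bool (y n)) (fun n => nat_of_bool (y' n)).
    by move=> /(congr1 (fun a => a n)); move: yn; case: (y n); case: (y' n).
  apply: (sepS _ _ k p0 p0 ky ny); [by have [] := Lp0 k (y k)|by have [] := Lp0 k (y' k)|].
  by rewrite -/(f y) -/(f y') fyy'.
pose inL n m := [set h : C | forall z y, L n m (cofun h z - f y)].
have inL_ex h n : exists m, inL n m h.
  have [|m mL] := Lcompact n
    ((fun zy => cofun h zy.1 - f zy.2) @` ([set: Z] `*` [set: cantor_space])).
    apply: continuous_compact; last by apply: compact_setX => //; exact: cantor_space_compact.
    apply: continuous_subspaceT.
    apply: (comp_continuous (f := fun zy : Z * cantor_space => (cofun h zy.1, f zy.2))
      (g := fun v : X * X => v.1 - v.2)); last exact: sub_continuous.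
    apply: pair_continuous.
      exact: comp_continuous (@fst_continuous _ _) (@cofun_continuous _ _ h).
    exact: comp_continuous (@snd_continuous _ _) cf.
  by exists m => z y; apply: mL; exists (z, y).
have open_inL n m : open (inL n m).
  have oT : open [set g | forall y, L n m (g - f y)].
    rewrite openE => g /= gL; rewrite /interior.
    suff : \forall g' \near g, [set: cantor_space] `<=` [set y | L n m (g' - f y)].
      by apply: filterS => g' g'L y; exact: g'L.
    move: cantor_space_compact => /compact_near_coveringP/(_ _ (nbhs g)
      (fun g' y => L n m (g' - f y))); apply => y _.
    have : continuous (fun v : cantor_space * X => v.2 - f v.1).
      apply: (comp_continuous (f := fun v : cantor_space * X => (v.2, f v.1))
        (g := fun v : X * X => v.1 - v.2)); last exact: sub_continuous.
      apply: pair_continuous; first exact: snd_continuous.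
      exact: comp_continuous (@fst_continuous _ _) cf.
    move=> /(_ (y, g) (L n m))[|[P Q] /= [Py Qg] PQL].
      by apply: open_nbhs_nbhs; split=> //; have [] := Lp0 n m.
    by exists (P, Q).
  rewrite openE => h hL; rewrite /interior.
  have := compact_open_map_nbhs (h := h) cZ oT (fun z _ => hL z).
  by apply: filterS => k kL z y; exact: kL.
(* Taking the least bound makes it a Borel function of [h]. *)
have /choice[kap kapP] : forall hn : C * nat, exists m, inL hn.2 m hn.1 /\
    forall j, inL hn.2 j hn.1 -> (m <= j)%N.
  move=> [h n] /=; have exm : exists m, `[< inL n m h >].
    by have [m hm] := inL_ex h n; exists m; exact/asboolP.
  case: (ex_minnP exm) => m /asboolP hm mmin; exists m; split=> // j hj.
  by apply: mmin; exact/asboolP.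
have borel_kap n m : borel [set h | kap (h, n) = m].
  have -> : [set h | kap (h, n) = m] =
      inL n m `&` \bigcap_(j in [set j | (j < m)%N]) ~` inL n j.
    apply/seteqP; split=> [h /= <-|h [hm hj] /=].
      have [hk kmin] := kapP (h, n); split=> // j /= jk hj.
      by have := kmin j hj; rewrite leqNgt jk.
    have [hk kmin] := kapP (h, n); apply/eqP; rewrite eqn_leq (kmin _ hm) /= leqNgt.
    by apply/negP => /hj; exact.
  apply: borelI; first exact: borel_open.
  by apply: borel_bigcap => // j _; apply: borelC; exact: borel_open.
have [B [oB nB]] := polish_countable_base pC.
pose code h n := `[< B n h >].
have code_inj h h' : code h = code h' -> h = h'.
  move=> hh'; apply: (polish_hausdorff pC) => P Q /nB[n Bh BP] Qh'; exists h'.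
  split; last exact: nbhs_singleton.
  apply: BP; apply/asboolP; rewrite -/(code h' n) -hh'; exact/asboolP.
(* The index [n] records the bound [kap (h, n)], the [n]th bit of the code of [h] and
   the [n]th bit of [x]; it is at least [kap (h, n)]. *)
pose enc (k : nat) (b c : bool) := ((k.*2 + b).*2 + c)%N.
have enc_inj k b c k' b' c' : enc k b c = enc k' b' c' -> [/\ k = k', b = b' & c = c'].
  have dec (m : nat) (e : bool) : (odd (m.*2 + e) = e) * ((m.*2 + e)./2 = m).
    by rewrite addnC oddD odd_double addbF oddb half_bit_double.
  move=> E; have cc' : c = c' by rewrite -(dec (k.*2 + b)%N c) -/(enc k b c) E dec.
  have kb : (k.*2 + b = k'.*2 + b')%N.
    by rewrite -(dec (k.*2 + b)%N c) -/(enc k b c) E dec.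
  have bb' : b = b' by rewrite -(dec k b) kb dec.
  by split=> //; rewrite -(dec k b) kb dec.
pose idx (w : C * cantor_space) n := enc (kap (w.1, n)) (code w.1 n) (w.2 n).
have idx_inj w w' : idx w = idx w' -> w = w'.
  move=> ww'; have dec n := enc_inj _ _ _ _ _ _ (congr1 (fun a => a n) ww').
  rewrite (surjective_pairing w) (surjective_pairing w'); congr (_, _).
    by apply: code_inj; apply/funext => n; have [] := dec n.
  by apply/funext => n; have [] := dec n.
have idx_L w n z y : L n (idx w n) (cofun w.1 z - f y).
  have [hk _] := kapP (w.1, n); apply: Lmono (hk z y).
  by rewrite /idx /enc -!addnn -!addnA leq_addr.
exists f, (S \o idx); split=> //.
- apply: borel_map_open => O oO.
  have -> : (S \o idx) @^-1` O = \bigcup_(s in [set s | forall a,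
      mkseq a (size s) = s -> O (S a)]) \bigcap_(i in [set i | (i < size s)%N])
        [set w | idx w i = nth 0%N s i].
    apply/seteqP; split=> [w /= Ow|w [s /= sO ws]].
      have [n nO] := cS _ _ (open_nbhs_nbhs (conj oO Ow)).
      exists (mkseq (idx w) n) => /=.
        rewrite size_mkseq => a aE; apply: nO => i i_n.
        by rewrite -(nth_mkseq 0%N a i_n) aE nth_mkseq.
      by move=> i /=; rewrite size_mkseq => i_n; rewrite nth_mkseq.
    apply: sO; apply: (@eq_from_nth _ 0%N); rewrite size_mkseq// => i i_s.
    by rewrite nth_mkseq//; exact: ws.
  apply: borel_bigcup => [|s _]; first exact: countableP.
  apply: borel_bigcap => // i _; move: (nth _ _ _) => m.
  have -> : [set w | idx w i = m] = \bigcup_(k in [set k : nat * bool * bool |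
      enc k.1.1 k.1.2 k.2 = m]) ((fst @^-1` [set h | kap (h, i) = k.1.1]) `&`
        (fst @^-1` [set h | code h i = k.1.2]) `&`
        (snd @^-1` [set x : cantor_space | x i = k.2])).
    apply/seteqP; split=> [w wm|w [[[k b] c] /= km [[kk bb] cc]]].
      by exists (kap (w.1, i), code w.1 i, w.2 i).
    by rewrite /idx kk bb cc.
  apply: borel_bigcup => [|[[k b] c] _ /=]; first exact: countableP.
  apply: borelI; first apply: borelI.
  + by apply: (continuous_borel_map (@fst_continuous _ _)); exact: borel_kap.
  + apply: (continuous_borel_map (@fst_continuous _ _)).
    have bB : borel [set h | code h i].
      rewrite (_ : [set h | code h i] = B i); first exact: borel_open.
      by apply/seteqP; split=> h /asboolP.
    case: b => //; rewrite (_ : [set h | _] = ~` [set h | code h i]); first exact: borelC.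
    by apply/seteqP; split=> h /=; case: (code h i).
  + apply: (continuous_borel_map (@snd_continuous _ _)).
    have bx := cantor_coord_borel i.
    case: c => //; rewrite (_ : [set x : cantor_space | _] = ~` [set x : cantor_space | x i]).
      exact: borelC.
    by apply/seteqP; split=> x /=; case: (x i).
- move=> h x U /cS[n nU]; apply/cantor_cylinderP; exists n => x' xx'.
  by apply: nU => i i_n; rewrite /idx /= xx'.
- move=> w w' z z' y y' E; apply: idx_inj; apply: contrapT => /first_diff[n ln nn].
  exact: sepS ln nn (idx_L w n z y) (idx_L w' n z' y') E.
Qed.

(** A diagonal argument.  Over a pair [(h, x)] the set [A] consists of the points of
    [range h] that belong to the section at [x] of the set with code [x], provided
    that [h] maps a large set of arguments there; [E] contains, for every pair with
    a nonempty section, one point of the section translated by [t (h, x)].  If a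
    map [h] witnessed that a hull [H] of [E] is Haar-small, let [x] be a code of the
    complement of the pullback of [H] under [(x, g) |-> t (h, x) + g].  The section
    of [A] over [(h, x)] avoids [H] after translation, so it is empty, so [h] maps
    only a small set of arguments outside a translate of [H], so a large one
    into it. *)
Theorem borel_haar1_without_hull (I : set (set Z)) (d : Order.disp_t)
    (W : orderType d) (a : W) : sigma_ideal I -> ~ I [set: Z] ->
  class_on_class R borel borel I -> metrizable R Z -> countable [set: W] ->
  well_founded (fun a b : W => (a < b)%O) -> ord_ge1 a ->
  ~ locally_compact [set: X] ->
  exists E : set X, [/\ borel E, haar1 E &
    forall H : set X, Pi0 a H -> haar I H -> ~ E `<=` H].
Proof.
move=> idI nI borelI_borel mZ cW W_wf a1 nlc.
have pK := polish_cantor R.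
have [f [t [cf injf bt ct tsep]]] := disjoint_translates nlc.
have [U bU UP] := universal_additive cW W_wf (polish_prod pK pX) a1.
pose A0 := [set v : C * cantor_space * X | U (v.1.2, (v.1.2, v.2)) /\
  exists z, cofun v.1.1 z = v.2].
have bA0 : borel A0.
  apply: borelI.
    apply: (continuous_borel_map (f := fun v : C * cantor_space * X => (v.1.2, (v.1.2, v.2)))) bU.
    have c12 := comp_continuous (@fst_continuous (C * cantor_space)%type X) (@snd_continuous _ _).
    apply: pair_continuous => //; apply: pair_continuous => //.
    exact: snd_continuous.
  apply: (continuous_borel_map (f := fun v : C * cantor_space * X => (v.1.1, v.2))
    _ (borel_closed closed_range_relation)).
  apply: pair_continuous; last exact: snd_continuous.
  exact: comp_continuous (@fst_continuous _ _) (@fst_continuous _ _).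
pose D := [set w : C * cantor_space | ~ I (cofun w.1 @^-1` xsection A0 w)].
have bD : borel D := borelC (borel_preimage_ideal cZ mZ borelI_borel pX pK bA0).
pose A := A0 `&` (fst @^-1` D).
have sectA w : D w -> xsection A w = xsection A0 w.
  by move=> Dw; apply/seteqP; split=> g /xsectionP; [case|] => *; apply/xsectionP.
have [|w|phi [bphi phiA phi1]] :=
    ideal_uniformization cZ mZ idI borelI_borel pX pK (A := A).
- by apply: borelI => //; exact: (continuous_borel_map (@fst_continuous _ _)).
- have [Dw|nDw] := pselect (D w); first by right; rewrite sectA.
  by left; rewrite -subset0 => g /xsectionP[].
have phi_uniq w g g' : phi (w, g) -> phi (w, g') -> g = g'.
  move=> wg wg'; have [|g0 wg0] := phi1 w.
    by exists g; apply/xsectionP; exact: phiA.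
  have /xsectionP := wg; have /xsectionP := wg'.
  by rewrite wg0 => -> ->.
have phi_range w g : phi (w, g) -> exists z, cofun w.1 z = g by move=> /phiA[[]].
pose shift (v : C * cantor_space * X) := t v.1 + v.2.
have shift_inj (y y' : cantor_space) v v' : phi v -> phi v' ->
    shift v - f y = shift v' - f y' -> v = v'.
  move: v v' => [w g] [w' g'] vg vg'; rewrite /shift /= -!addrA => E.
  have [z gz] := phi_range _ _ vg; have [z' gz'] := phi_range _ _ vg'.
  rewrite -gz -gz' in E; have ww' := tsep _ _ _ _ _ _ E.
  by rewrite -ww' in vg' *; rewrite (phi_uniq _ _ _ vg vg').
exists (shift @` phi); split.
- apply: (injective_borel_image (polish_prod (polish_prod pC pK) pX) pX) => //.
    have [B cB] := polish_countable_base pX.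
    apply: (borel_map_comp (f := fun v : C * cantor_space * X => (t v.1, v.2))
      (g := fun z : X * X => z.1 + z.2)).
      apply: (borel_map_pair cB cB).
        exact: borel_map_comp (continuous_borel_map (@fst_continuous _ _)) bt.
      exact: (continuous_borel_map (@snd_continuous _ _)).
    exact: (continuous_borel_map (@add_continuous X)).
  move=> v v' /set_mem vphi /set_mem vphi' E.
  by apply: (shift_inj point point) => //; rewrite E.
- exists f => // x y y' [_ [v vphi <-] fy] [_ [v' vphi' <-] fy'].
  apply: injf; rewrite -fy -fy'; congr (_ + x); congr shift.
  have subK (u : X) : u - (u + x) = - x by rewrite opprD addNKr.
  by apply: (shift_inj y y') => //; rewrite -fy -fy' !subK.
move=> H PH [h ch hH] EH.
pose k : C := (mkcts ch : continuousType Z X).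
pose S0 := (fun v : cantor_space * X => t (k, v.1) + v.2) @^-1` H.
have PS0 : multiplicative_class a S0.
  apply: multiplicative_class_preimage PH.
  apply: (comp_continuous (f := fun v : cantor_space * X => (t (k, v.1), v.2))
    (g := fun z : X * X => z.1 + z.2)); last exact: add_continuous.
  apply: pair_continuous; last exact: snd_continuous.
  exact: comp_continuous (@fst_continuous _ _) (ct k).
have [|x Ux] := UP (~` S0); first by rewrite setCK.
pose w : C * cantor_space := (k, x).
have UxP z : U (x, (x, h z)) <-> ~ H (t w + h z).
  split=> [Uz|nH].
    by have /xsectionP : U (x, (x, h z)) := Uz; rewrite Ux.
  have : (~` S0) (x, h z) by [].
  by rewrite -Ux => /xsectionP.
have I0 : I (cofun w.1 @^-1` xsection A0 w).
  apply: contrapT => Dw; have [|g wg] := phi1 w.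
    rewrite sectA//; apply: contrapT => /set0P/negP/negPn/eqP A00.
    by apply: Dw; rewrite A00 preimage_set0; exact: sigma_ideal0.
  have vphi : phi (w, g) by apply/xsectionP; rewrite wg.
  have [z gz] := phi_range _ _ vphi; have [[Ug _] _] := phiA _ vphi.
  move: Ug; rewrite /= -gz => /UxP; apply; apply: EH.
  by exists (w, g) => //; rewrite /shift /= -gz.
apply: (sigma_ideal_compl idI nI I0).
apply: (sigma_ideal_sub idI) (hH (- t w)) => z nz.
exists (t w + h z); last by rewrite addrC addKr.
apply: contrapT => nH; apply: nz; apply/xsectionP.
by split; [exact/UxP|exists z].
Qed.

End no_hull.

Theorem theorem13p11 (R : realType) (Z : topologicalType) (I : set (set Z))
    (Z_compact : compact [set: Z]) (Z_metrizable : metrizable R Z)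
    (I_sigma_ideal : sigma_ideal I)
    (I_cover : \bigcup_(A in I) A = [set: Z]) (I_proper : ~ I [set: Z])
    (I_borel_on_borel : class_on_class R borel borel I)
    (d : Order.disp_t) (W : orderType d) (W_countable : countable [set: W])
    (W_wf : well_founded (fun a b : W => (a < b)%O))
    (alpha : W) (alpha_ge1 : ord_ge1 alpha) :
  property_H R I borel (Pi0 alpha) /\
  forall X : topologicalZmodType, polish R X -> ~ locally_compact [set: X] ->
    (exists e : Z -> X, embedding e) ->
    exists E : set X,
      [/\ borel E, haar1 E &
          forall H : set X, Pi0 alpha H -> haar I H -> ~ E `<=` H].
Proof.
split=> [|X pX nlc _]; first exact: property_H_borel_Pi0.
exact: (borel_haar1_without_hull Z_compact (polish_compact Z_compact Z_metrizable) pX).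
Qed.
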